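(* Let $(T_t)_{t\ge 0}$ be a $C_0$-semigroup of continuous linear operators on a separable Banach space $X$. Suppose there exist a dense subset $X_0\subset X$ and maps $S_t:X_0\to X_0$, $t>0$, such that: (i) $T_tS_tx=x$ for all $t>0$ and $x\in X_0$, and $T_tS_rx=S_{r-t}x$ for all $r>t>0$ and $x\in X_0$; (ii) $t\mapsto T_tx$ is Pettis integrable on $[0,\infty)$ for all $x\in X_0$; (iii) $t\mapsto S_tx$ is Pettis integrable on $[0,\infty)$ for all $x\in X_0$. Then there is a $(T_t)_{t\ge 0}$-invariant strongly mixing Borel probability measure $\mu$ on $X$ with full support.
   Context: A $C_0$-semigroup on a Banach space $X$ is a family $(T_t)_{t\ge 0}$ of continuous linear operators on $X$ with $T_0=I$, $T_{t+s}=T_t\circ T_s$ and $\lim_{s\to t}T_sx=T_tx$ for all $x\in X$ and $s,t\ge 0$. Let $\mathfrak{B}$ be the Borel $\sigma$-algebra of $X$ and $\mu$ a Borel probability measure on $X$. The measure $\mu$ is $(T_t)_{t\ge 0}$-invariant if $\mu(T_t^{-1}(A))=\mu(A)$ for all $A\in\mathfrak{B}$ and all $t\ge 0$. It is strongly mixing (for $(T_t)_{t\ge 0}$) if $\lim_{t\to\infty}\mu(A\cap T_t^{-1}(B))=\mu(A)\mu(B)$ for all $A,B\in\mathfrak{B}$. It has full support if $\mu(U)>0$ for every non-empty open set $U\subset X$. Pettis integrability on $[0,\infty)$ is with respect to Lebesgue measure: a function $f:[0,\infty)\to X$ is Pettis integrable if, for every $\varphi$ in the topological dual $X'$, the scalar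 function $\varphi\circ f$ is measurable and belongs to $L_1([0,\infty))$, and for every measurable $E\subseteq[0,\infty)$ there is $x_E\in X$ with $\varphi(x_E)=\int_E\varphi\circ f\,dt$ for all $\varphi\in X'$. In (iii), the value of the function at $t=0$ (where $S_t$ is not defined) is immaterial, since $\{0\}$ is a null set. The maps $S_t$ are not assumed linear or continuous, and $X_0$ is not assumed to be a linear subspace. *)

(* Defs.v *)
From HB Require Import structures.
From mathcomp Require Import all_boot all_order all_algebra.
From mathcomp Require Import complex.
From mathcomp Require Import all_classical all_reals all_analysis.

Set Implicit Arguments.
Unset Strict Implicit.
Unset Printing Implicit Defensive.

Import Order.TTheory GRing.Theory Num.Theory.
Import numFieldNormedType.Exports.

Local Open Scope classical_set_scope.
Local Open Scope ring_scope.

(* A Banach space may be real or complex: its scalar field is R or R[i]. *)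
Variant scalars := RealScalars | ComplexScalars.

Definition scalar_field (R : realType) (k : scalars) : numFieldType :=
  match k with
  | RealScalars => R : numFieldType
  | ComplexScalars => R[i] : numFieldType
  end.

(* Integrals over sets of reals are taken with respect to the completed
   Lebesgue measure, so that "measurable" means Lebesgue (not merely Borel)
   measurable. *)
Local Notation lebesgue := (@completed_lebesgue_measure _).

Definition lebesgue_measurable (R : realType) (E : set R) : Prop :=
  measurable (E : set (caratheodory_type (wlength (@idfun R))^*%mu)).

Definition scalar_integrable (R : realType) (k : scalars) (D : set R) :
    (R -> scalar_field R k) -> Prop :=
  match k return (R -> scalar_field R k) -> Prop with
  | RealScalars => fun g => lebesgue.-integrable D (EFin \o g)
  | ComplexScalars => fun g =>
      lebesgue.-integrable D (fun t => (complex.Re (g t))%:E) /\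
      lebesgue.-integrable D (fun t => (complex.Im (g t))%:E)
  end.

Definition scalar_integral (R : realType) (k : scalars) (D : set R) :
    (R -> scalar_field R k) -> scalar_field R k :=
  match k return (R -> scalar_field R k) -> scalar_field R k with
  | RealScalars => fun g => \int[lebesgue]_(t in D) g t
  | ComplexScalars => fun g =>
      Complex (\int[lebesgue]_(t in D) complex.Re (g t))
              (\int[lebesgue]_(t in D) complex.Im (g t))
  end.

(* A family indexed by [0, +oo[ (or by ]0, +oo[) is a function on R whose
   values at the other times are irrelevant. *)

Definition pettis_integrable (R : realType) (k : scalars)
    (X : normedModType (scalar_field R k)) (f : R -> X) : Prop :=
  (forall phi : {linear X -> (scalar_field R k)^o}, continuous phi ->
     scalar_integrable `[0, +oo[ (phi \o f)) /\
  (forall E : set R, lebesgue_measurable E -> E `<=` `[0, +oo[ ->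
     exists xE : X, forall phi : {linear X -> (scalar_field R k)^o},
       continuous phi -> phi xE = scalar_integral E (phi \o f)).

Record C0_semigroup (R : realType) (k : scalars)
    (X : normedModType (scalar_field R k)) (T : R -> X -> X) : Prop := {
  semigroup_linear : forall t, 0 <= t -> linear (T t) ;
  semigroup_continuous : forall t, 0 <= t -> continuous (T t) ;
  semigroup0 : forall x, T 0 x = x ;
  semigroupD : forall t s x, 0 <= t -> 0 <= s -> T (t + s) x = T t (T s x) ;
  semigroup_cvg : forall x, {within `[0, +oo[, continuous (fun t => T t x)}
}.

Definition separable (X : topologicalType) : Prop :=
  exists2 D : set X, countable D & dense D.

Definition borel (X : ptopologicalType) := g_sigma_algebraType (@open X).

Section measures.
Context (R : realType) (X : ptopologicalType).
Implicit Types (T : R -> X -> X) (mu : probability (borel X) R).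
Local Open Scope ereal_scope.

Definition invariant_measure T mu : Prop :=
  forall (A : set (borel X)) (t : R), measurable A -> (0 <= t)%R ->
    mu (T t @^-1` A) = mu A.

Definition strongly_mixing T mu : Prop :=
  forall A B : set (borel X), measurable A -> measurable B ->
    mu (A `&` T t @^-1` B) @[t --> +oo%R] --> mu A * mu B.

Definition full_support mu : Prop :=
  forall U : set X, open U -> U !=set0 -> 0 < mu U.

End measures.

(* Main.v *)
(* For x in X0 put u(s) = T_s x if s >= 0 and u(s) = S_(-s) x if s < 0, so that
   T_t u(s) = u(s + t). If E is a random set of times, T_t maps the Pettis
   integral of u over E to the integral of u over E + t; hence, when the law of E
   is invariant under translations and mixing, so is the law of this random
   vector under the semigroup. Take for E the union of the intervals ]p, p + d[
   over the points p of a Poisson process, and sum the integrals of d^-1 u over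
   independent such sets, for x running through a dense sequence in X0 and d
   tending to 0. By an Orlicz-Pettis argument the integral of u over any set of
   times outside a large window is small, so the sum converges almost surely if
   the intensities decrease fast enough. The support is full because, with
   positive probability, the only point that matters is a point of one chosen
   process close to 0, and d^-1 times the integral of u over ]0, d[ is close to x.
   The Poisson processes are encoded by the countably many bits telling which
   rational intervals are hit; the probability that F contains no point being
   exp(- m F), positivity of the joint laws is the complete monotonicity of this
   function of F. This gives invariance and mixing for rational times, whence for
   all times by strong continuity. *)

From HB Require Import structures.
From Stdlib Require List.
Require Import Defs.
From mathcomp Require Import all_boot all_order all_algebra.
From mathcomp Require Import complex ring lra.
From mathcomp Require Import all_classical all_reals all_analysis measurable_realfun.

Set Implicit Arguments.
Unset Strict Implicit.
Unset Printing Implicit Defensive.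

Import Order.TTheory GRing.Theory Num.Theory.
Import numFieldNormedType.Exports.

Local Open Scope classical_set_scope.
Local Open Scope ring_scope.

(** * Void probabilities and Poisson configurations *)

(** Pettis integrability supplies integrals of [u] over sets and no control of the norm of [u], so
    the randomness enters through sets of times and not through a random weight. The parameters have
    to be fixed in one order: the vector and [delta n] determine [u n]; its Orlicz-Pettis window is
    then known; only after that is the intensity chosen, so small that the mean number of points of
    mark [n] in the enlarged window is at most [2^-1 ^+ n]. Almost surely only finitely many windows
    are then hit, and every other term has norm at most [2^-1 ^+ n], so the sum converges
    absolutely. No set of points is ever built: a configuration is an arbitrary family of bits, and
    the single property of a point set that is used, that an interval containing a hit interval is
    hit, holds almost surely. Bits indexed by rational intervals can be translated by rational times
    only; this is the origin of the detour through rational times. *)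

Section complete_monotonicity.
Context d (Y : measurableType d) (R : realType) (m : {measure set Y -> \bar R}).

Implicit Types (f g : set Y -> R) (b : bool) (c F A : set Y).

Definition alternate b c f : set Y -> R :=
  fun F => if b then f F - f (F `|` c) else f (F `|` c).

(* If [f F] is the probability that [F] contains no point, this is the
   probability (by inclusion-exclusion) that the cells marked [true] are hit and
   those marked [false] are not. *)
Fixpoint alternates (l : seq (bool * set Y)) f : R :=
  if l is (b, c) :: l' then alternates l' (alternate b c f) else f set0.

(** [alternates l f] evaluates [f] only at unions of cells of [l]. An identity that needs [F]
    measurable, or [F] inside a fixed set, is therefore enough; [P] records such a restriction. *)
Lemma eq_alternates (P : set Y -> Prop) l f g :
  P set0 -> (forall F b c, P F -> List.In (b, c) l -> P (F `|` c)) ->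
  (forall F, P F -> f F = g F) -> alternates l f = alternates l g.
Proof.
elim: l f g => [|[b c] l IH] f g P0 PU fg /=; first exact: fg.
apply: IH => //.
  by move=> F b' c' PF lc; apply: PU PF _; right; exact: lc.
move=> F PF; have PFc : P (F `|` c) by apply: PU PF _; left.
by rewrite /alternate !fg.
Qed.

Lemma alternatesD l f g :
  alternates l (fun F => f F + g F) = alternates l f + alternates l g.
Proof.
elim: l f g => [|[b c] l IH] f g //=; rewrite -IH; congr alternates.
by apply/funext => F; rewrite /alternate; case: b => //; rewrite opprD addrACA.
Qed.

Lemma alternatesZ k l f :
  alternates l (fun F => k * f F) = k * alternates l f.
Proof.
elim: l f => [|[b c] l IH] f //=; rewrite -IH; congr alternates.
by apply/funext => F; rewrite /alternate; case: b => //; rewrite mulrBr.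
Qed.

Definition measurable_cells (l : seq (bool * set Y)) :=
  forall b c, List.In (b, c) l -> measurable c.

(** Complete monotonicity, truncated at [n] cells. The inductions on products and exponentials run
    on this bound, each cell consumed lowering it by one. *)
Definition monotone_upto n f :=
  forall l, (size l <= n)%N -> measurable_cells l -> 0 <= alternates l f.

Lemma monotone_upto_alternate n f b c : measurable c ->
  monotone_upto n.+1 f -> monotone_upto n (alternate b c f).
Proof.
move=> mc Mf l sl ml; apply: (Mf ((b, c) :: l)) => //.
by move=> b' c' [[_ <-]//|/ml].
Qed.

Lemma monotone_upto_leq n k f : (k <= n)%N ->
  monotone_upto n f -> monotone_upto k f.
Proof. by move=> kn Mf l lk; apply: Mf; exact: leq_trans kn. Qed.

(* Leibniz rule: the difference of f g is (difference of f) g + (shifted f)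
   (difference of g). *)
Lemma monotone_uptoM n f g : monotone_upto n f -> monotone_upto n g ->
  monotone_upto n (fun F => f F * g F).
Proof.
elim: n f g => [|n IH] f g Mf Mg [|[b c] l] //= sl ml.
- by apply: mulr_ge0; [apply: (Mf [::])|apply: (Mg [::])].
- by apply: mulr_ge0; [apply: (Mf [::])|apply: (Mg [::])].
have mc : measurable c by apply: (ml b); left.
have ml' : measurable_cells l by move=> b' c' H; apply: (ml b'); right.
have Mf0 := monotone_upto_alternate false mc Mf.
have Mg0 := monotone_upto_alternate false mc Mg.
have Mf1 := monotone_upto_alternate true mc Mf.
have Mg1 := monotone_upto_alternate true mc Mg.
case: b ml => ml; last exact: (IH _ _ Mf0 Mg0).
rewrite [alternate _ _ _](_ : _ = fun F => alternate true c f F * g F +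
    alternate false c f F * alternate true c g F); last first.
  by apply/funext => F; rewrite /alternate mulrBl mulrBr addrA subrK.
rewrite alternatesD addr_ge0//.
  exact: (IH _ _ Mf1 (monotone_upto_leq (leqnSn n) Mg)).
exact: (IH _ _ Mf0 Mg1).
Qed.

Lemma fineD_measure A F c : measurable A -> (m A < +oo)%E ->
  measurable F -> measurable c ->
  fine (m (A `\` F)) = fine (m ((A `\` c) `\` F)) + fine (m ((A `&` c) `\` F)).
Proof.
move=> mA Aoo mF mc.
have fin B : measurable B -> B `<=` A -> m B \is a fin_num.
  by move=> mB BA; rewrite ge0_fin_numE//; apply: le_lt_trans Aoo; rewrite le_measure// inE.
rewrite -fineD.
- rewrite -measureU; [congr (fine (m _))|..].
  + apply/seteqP; split => y; last by move=> [[[Ay _] nF]|[[Ay _] nF]].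
    by move=> [Ay nF]; have [cy|ncy] := pselect (c y); [right|left].
  + by apply: measurableD => //; exact: measurableD.
  + by apply: measurableD => //; exact: measurableI.
  + by apply/seteqP; split => y // [[[_ nc] _] [[_ cy] _]].
- by apply: fin => [|y [[]]//]; apply: measurableD => //; exact: measurableD.
- by apply: fin => [|y [[]]//]; apply: measurableD => //; exact: measurableI.
Qed.

(** The two claims feed each other. With the sign [true], the difference along [c] factors as exp
    m((A \ c) \ F) times exp m((A & c) \ F) - 1; these are functions of the two kinds, known at
    order [n], and the Leibniz rule covers their product. The constant 1 disappears in such a
    difference. With the sign [false], [A] merely shrinks to A \ c. *)
Lemma monotone_upto_exp n A : measurable A -> (m A < +oo)%E ->
  monotone_upto n (fun F => expR (fine (m (A `\` F)))) /\
  monotone_upto n (fun F => expR (fine (m (A `\` F))) - 1).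
Proof.
elim: n A => [|n IH] A mA Aoo.
  split=> -[|//] /= _ _; first exact: expR_ge0.
  by rewrite subr_ge0 -[leLHS]expR0 ler_expR fine_ge0.
have sub c : measurable c -> [/\ measurable (A `\` c), (m (A `\` c) < +oo)%E,
    measurable (A `&` c) & (m (A `&` c) < +oo)%E].
  move=> mc; have mD := measurableD mA mc; have mI := measurableI _ _ mA mc.
  split => //; by apply: le_lt_trans Aoo; rewrite le_measure ?inE//.
have step l : (size l <= n)%N -> measurable_cells l ->
   forall c, measurable c ->
   0 <= alternates l (alternate true c (fun F => expR (fine (m (A `\` F))))).
  move=> sl ml c mc; have [m1 f1 m2 f2] := sub c mc.
  rewrite (@eq_alternates measurable _ _ (fun F => expR (fine (m ((A `\` c) `\` F))) *
     (expR (fine (m ((A `&` c) `\` F))) - 1))) //.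
  - by apply: monotone_uptoM sl ml; [exact: (IH _ m1 f1).1|exact: (IH _ m2 f2).2].
  - by move=> F b' c' mF /ml mc'; exact: measurableU.
  - move=> F mF; rewrite /alternate (fineD_measure mA Aoo mF mc) expRD mulrBr mulr1.
    by congr (_ - expR (fine (m _))); rewrite setUC setDDl.
split=> -[|[b c] l] /= sl ml; first exact: expR_ge0.
- have mc : measurable c by apply: (ml b); left.
  have ml' : measurable_cells l by move=> b' c' H; apply: (ml b'); right.
  case: b ml => ml; first exact: step.
  have [m1 f1 m2 f2] := sub c mc.
  rewrite (_ : alternate _ _ _ = fun F => expR (fine (m ((A `\` c) `\` F)))).
    exact: (IH _ m1 f1).1.
  by apply/funext => F; rewrite /alternate setUC setDDl.
- by rewrite subr_ge0 -[leLHS]expR0 ler_expR fine_ge0.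
- have mc : measurable c by apply: (ml b); left.
  have ml' : measurable_cells l by move=> b' c' H; apply: (ml b'); right.
  case: b ml => ml.
    rewrite (_ : alternate _ _ _ = alternate true c (fun F => expR (fine (m (A `\` F))))).
      exact: step.
    by apply/funext => F; rewrite /alternate; ring.
  have [m1 f1 m2 f2] := sub c mc.
  rewrite (_ : alternate _ _ _ = fun F => expR (fine (m ((A `\` c) `\` F))) - 1).
    exact: (IH _ m1 f1).2.
  by apply/funext => F; rewrite /alternate setUC setDDl.
Qed.

Definition void_prob F : R := expR (- fine (m F)).

(** All cells lie in one set [A] of finite measure, and for [F] inside [A] the void probability is
    the constant exp(- m A) times exp m(A \ F). In the latter form the factors of a difference are
    again exponentials with a positive sign, to which the induction applies. *)
Lemma alternates_void_ge0 l : measurable_cells l ->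
  (forall b c, List.In (b, c) l -> (m c < +oo)%E) -> 0 <= alternates l void_prob.
Proof.
move=> ml foo.
have [A [mA Aoo lA]] : exists A, [/\ measurable A, (m A < +oo)%E &
    forall b c, List.In (b, c) l -> c `<=` A].
  elim: l ml foo => [|[b c] l IH] ml foo.
    by exists set0; split; rewrite ?measure0.
  have [||A [mA Aoo lA]] := IH.
  - by move=> b' c' H; apply: (ml b'); right.
  - by move=> b' c' H; apply: (foo b'); right.
  have mc : measurable c by apply: (ml b); left.
  exists (A `|` c); split; first exact: measurableU.
    apply: (@le_lt_trans _ _ (m A + m c)%E); last first.
      by rewrite lte_add_pinfty// (foo b)//; left.
    by apply: measureU2.
  move=> b' c' [[_ <-]|/lA cA] x; [by right|by move/cA; left].
have := (monotone_upto_exp (size l) mA Aoo).1 l (leqnn _) ml.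
move=> /(mulr_ge0 (expR_ge0 (- fine (m A)))); rewrite -alternatesZ.
rewrite (@eq_alternates (fun F => measurable F /\ F `<=` A) _ _ void_prob)//.
    by split.
  move=> F b c [mF FA] lc; split; first by apply: measurableU => //; exact: ml lc.
  by rewrite subUset; split => //; exact: lA lc.
move=> F [mF FA]; rewrite /void_prob -expRD; congr expR.
have fF : m F \is a fin_num.
  by rewrite ge0_fin_numE//; apply: le_lt_trans Aoo; rewrite le_measure// inE.
rewrite measureD// setIidr// fineB ?ge0_fin_numE//; last by rewrite -ge0_fin_numE.
by rewrite addrA addNr add0r.
Qed.

End complete_monotonicity.

(** * Random bits on the unit interval with prescribed word probabilities *)

Section random_bits.
Context (R : realType).

Fact measurable_itv01 : measurable (`[0, 1[%classic : set R).
Proof. exact: measurable_itv. Qed.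

Definition lebesgue01 := mrestr (@lebesgue_measure R) measurable_itv01.

HB.instance Definition _ := Measure.on lebesgue01.

Lemma lebesgue01T : lebesgue01 setT = 1%E.
Proof.
by rewrite /lebesgue01 /mrestr setTI lebesgue_measure_itv/= lte_fin ltr01 oppr0 adde0.
Qed.

HB.instance Definition _ := Measure_isProbability.Build _ _ _ lebesgue01 lebesgue01T.

(* The most recent bit comes first. *)
Fixpoint word (h : nat -> bool) (n : nat) : seq bool :=
  if n is n'.+1 then h n' :: word h n' else [::].

Variable q : seq bool -> R.
Hypotheses (q_nil : q [::] = 1) (q_ge0 : forall w, 0 <= q w)
  (q_cons : forall w, q w = q (true :: w) + q (false :: w)).

(* [0, 1[ is cut into consecutive intervals of length [q w], the intervals of
   the two extensions of [w] subdividing that of [w]. *)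
Fixpoint word_start (w : seq bool) : R :=
  if w is b :: w' then word_start w' + (if b then 0 else q (true :: w')) else 0.

Fixpoint word_at (n : nat) (x : R) : seq bool :=
  if n is n'.+1 then
    let w := word_at n' x in (x < word_start w + q (true :: w)) :: w
  else [::].

Definition bit_at n x : bool :=
  x < word_start (word_at n x) + q (true :: word_at n x).

Lemma word_bit_at x n : word (bit_at^~ x) n = word_at n x.
Proof. by elim: n => //= n ->. Qed.

Lemma word_atP w x : 0 <= x < 1 ->
  (word_at (size w) x = w) <-> (word_start w <= x < word_start w + q w).
Proof.
move=> x01; elim: w => [|b w IH] /=; first by rewrite q_nil add0r; split.
split.
  move=> [hb hw]; move: hb; rewrite hw; move/IH: hw => /andP[h1 h2].
  case: b => /=; first by rewrite addr0 => ->; rewrite h1.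
  by move/negbT; rewrite -leNgt -addrA -q_cons h2 andbT.
move=> /andP[h1 h2].
have hw : word_at (size w) x = w.
  apply/IH; case: b h1 h2 => h1 h2.
    rewrite addr0 in h1 h2; rewrite h1 (lt_le_trans h2)// lerD2l [leRHS]q_cons.
    by rewrite lerDl.
  rewrite -addrA -q_cons in h2; rewrite h2 andbT (le_trans _ h1)//.
  by rewrite lerDl.
rewrite hw; congr cons; case: b h1 h2 => h1 h2; first by rewrite addr0 in h2.
by apply/negbTE; rewrite -leNgt.
Qed.

Lemma word_itv_sub w : 0 <= word_start w /\ word_start w + q w <= 1.
Proof.
elim: w => [|b w [h1 h2]] /=; first by rewrite q_nil add0r.
case: b; split.
- by rewrite addr0.
- by rewrite addr0 (le_trans _ h2)// lerD2l [leRHS]q_cons lerDl.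
- by rewrite addr_ge0.
- by rewrite -addrA -q_cons.
Qed.

Lemma measurable_word_at w n : measurable [set x | word_at n x = w].
Proof.
elim: n w => [|n IH] w.
  case: w => [|b w].
    by rewrite (_ : [set _ | _] = setT)//; apply/seteqP; split.
  by rewrite (_ : [set _ | _] = set0)//; apply/seteqP; split.
case: w => [|b w].
  by rewrite (_ : [set _ | _] = set0)//; apply/seteqP; split.
rewrite (_ : [set _ | _] = [set x | word_at n x = w] `&`
   (if b then [set` `]-oo, word_start w + q (true :: w)[]
    else [set` `[word_start w + q (true :: w), +oo[])).
  by apply: measurableI => //; case: b; exact: measurable_itv.
apply/seteqP; split => x /=.
  move=> [hb hw]; split => //; move: hb; rewrite hw.
  by case: b => /= h; rewrite in_itv/= ?h// andbT leNgt h.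
move=> [-> hb]; congr cons; move: hb; case: b; rewrite /= in_itv//= andbT.
by move=> h; apply/negbTE; rewrite -leNgt.
Qed.

Lemma measurable_bit_at n : measurable_fun setT (bit_at n).
Proof.
apply: (measurable_fun_bool true); rewrite setTI.
rewrite (_ : _ @^-1` _ = \bigcup_w ([set x | word_at n.+1 x = true :: w])).
  by apply: countable_bigcupT_measurable => // w; exact: measurable_word_at.
apply/seteqP; split => x /=.
  by move=> h; exists (word_at n x) => //=; congr cons.
by move=> [w _ [h _]].
Qed.

Lemma lebesgue01_word w :
  lebesgue01 [set x | word (bit_at^~ x) (size w) = w] = (q w)%:E.
Proof.
rewrite /lebesgue01 /mrestr.
have [h1 h2] := word_itv_sub w.
rewrite (_ : _ `&` _ = `[word_start w, word_start w + q w[%classic).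
  rewrite lebesgue_measure_itv/= lte_fin ltrDl -EFinD addrAC subrr add0r.
  by rewrite lt_def q_ge0 andbT; case: eqVneq => // ->.
apply/seteqP; split => x /=; rewrite !in_itv/= word_bit_at.
  by move=> [h x01]; apply/word_atP.
move=> /andP[h3 h4].
have x01 : 0 <= x < 1 by rewrite (le_trans h1 h3) (lt_le_trans h4 h2).
by split => //; apply/word_atP; rewrite ?h3.
Qed.

End random_bits.

Section void_process.
Context d (Y : measurableType d) (R : realType) (m : {measure set Y -> \bar R}).
Variable c : nat -> set Y.
Hypotheses (mc : forall i, measurable (c i)) (coo : forall i, (m (c i) < +oo)%E).

(** Patterns list the most recent bit first, so the head concerns the cell of index [size p']. A
    free entry [None] contributes no cell: this is how void probabilities of a few cells appear as
    marginals. *)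
Fixpoint pattern_cells (p : seq (option bool)) : seq (bool * set Y) :=
  if p is o :: p' then
    if o is Some b then (b, c (size p')) :: pattern_cells p' else pattern_cells p'
  else [::].

Definition pattern_prob p : R := alternates (pattern_cells p) (void_prob m).

Fixpoint agree (h : nat -> bool) (p : seq (option bool)) : Prop :=
  if p is o :: p' then
    (if o is Some b then h (size p') = b else True) /\ agree h p'
  else True.

Lemma pattern_prob_ge0 p : 0 <= pattern_prob p.
Proof.
have H b s : List.In (b, s) (pattern_cells p) -> exists i, s = c i.
  elim: p => [//|[b'|] p IH] //= [[_ <-]|/IH//].
  by exists (size p).
by apply: alternates_void_ge0 => b s /H[i ->].
Qed.

(** Forgetting a bit: the two values of [alternate] at a cell add up to the original function. This
    consistency turns the alternating sums into the marginals of a probability. *)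
Lemma pattern_prob_split p1 p2 : pattern_prob (p1 ++ None :: p2) =
  pattern_prob (p1 ++ Some true :: p2) + pattern_prob (p1 ++ Some false :: p2).
Proof.
rewrite /pattern_prob; elim: p1 (void_prob m) => [|[b|] p1 IH] f /=.
- by rewrite -alternatesD; congr alternates; apply/funext => F; rewrite /alternate subrK.
- by rewrite IH !size_cat.
- exact: IH.
Qed.

Lemma void_process_exists : exists (P : probability (measurableTypeR R) R)
  (h : nat -> R -> bool), (forall i, measurable_fun setT (h i)) /\
  forall p, P [set x | agree (h^~ x) p] = (pattern_prob p)%:E.
Proof.
pose q w := pattern_prob (map Some w).
have q_nil : q [::] = 1.
  by rewrite /q /pattern_prob /= /void_prob measure0 oppr0 expR0.
have q_cons w : q w = q (true :: w) + q (false :: w).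
  exact: (pattern_prob_split [::]).
have q_ge0 w : 0 <= q w by exact: pattern_prob_ge0.
exists (@lebesgue01 R), (bit_at q); split; first exact: measurable_bit_at.
move=> p.
have mh b i : measurable [set x | bit_at q i x = b].
  have := @measurable_bit_at _ q i measurableT [set b] I; rewrite setTI; exact.
have magree p' : measurable [set x | agree (bit_at q ^~ x) p'].
  elim: p' => [|o p' IH]; first exact: measurableT.
  apply: measurableI => //; case: o => [b|]; [exact: mh|exact: measurableT].
(* Induction on the number of free entries: a full pattern is an interval of the subdivision, and a
   free entry is resolved into its two values on both sides. *)
have [k] : exists k, (count (fun o : option bool => ~~ isSome o) p <= k)%N by exists (count (fun o : option bool => ~~ isSome o) p).
elim: k p => [|k IH] p.
  rewrite leqn0 => /eqP p0.
  have [w ->] : exists w, p = map Some w.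
    elim: p p0 => [|[b|] p IHp] //=; first by exists [::].
    by rewrite add0n => /IHp[w ->]; exists (b :: w).
  rewrite -[RHS]/((q w)%:E) -lebesgue01_word//; congr (@lebesgue01 R _).
  apply/funext => x; apply/propext; elim: w => [|b w IHw] //=.
  rewrite size_map; split; first by move=> [-> /IHw ->].
  by move=> [-> h]; split => //; apply/IHw.
move=> hk.
have [h0|] := boolP (all isSome p).
  apply: IH; rewrite (_ : count _ _ = 0%N)//; apply/eqP; rewrite -leqn0 leqNgt -has_count.
  by rewrite -all_predC; apply: sub_all h0 => o /=; rewrite negbK.
move=> /allPn[[b//|] pN _]; move: hk; case/splitPr: pN => p1 p2 hk.
rewrite pattern_prob_split EFinD -!IH.
- rewrite -measureU; [congr (@lebesgue01 R _)|exact: magree|exact: magree|].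
    apply/seteqP; split => x /=.
      elim: p1 {hk IH} => [|o p1 IHp] /=.
        by move=> [_ H]; case: (bit_at q (size p2) x); [left|right].
      by rewrite !size_cat/= => -[H /IHp[H'|H']]; [left|right].
    elim: p1 {hk IH} => [|o p1 IHp] /=.
      by move=> [[_ H]|[_ H]].
    by rewrite !size_cat/= => -[[H H']|[H H']]; split => //; apply: IHp; [left|right].
  apply/seteqP; split => x //=.
  elim: p1 {hk IH} => [|o p1 IHp] /=.
    by move=> [[-> _] []].
  by rewrite !size_cat/= => -[[H H'] [_ H'']]; apply: IHp.
- by move: hk; rewrite !count_cat/= [X in (X <= _)%N -> _]addnCA; exact.
- by move: hk; rewrite !count_cat/= [X in (X <= _)%N -> _]addnCA; exact.
Qed.

Definition void_pattern (S : {pred nat}) n : seq (option bool) :=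
  [seq if i \in S then Some false else None | i <- rev (iota 0 n)].

Lemma size_void_pattern S n : size (void_pattern S n) = n.
Proof. by rewrite size_map size_rev size_iota. Qed.

Lemma void_patternS S n : void_pattern S n.+1 =
  (if n \in S then Some false else None) :: void_pattern S n.
Proof. by rewrite /void_pattern -addn1 iotaD add0n rev_cat. Qed.

Lemma pattern_prob_void S n : pattern_prob (void_pattern S n) =
  void_prob m (\bigcup_(i in [set i | (i < n)%N && (i \in S)]) c i).
Proof.
rewrite /pattern_prob; elim: n (void_prob m) => [|n IH] f.
  by rewrite /= bigcup0.
rewrite void_patternS /=; case: ifPn => nS /=.
  rewrite size_void_pattern IH /alternate; congr f.
  apply/seteqP; split => y.
    move=> [[i /= /andP[ilt iS] ciy]|cny]; last by exists n => //=; rewrite ltnSn.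
    by exists i => //=; rewrite (ltn_trans ilt).
  move=> [i /= /andP[]]; rewrite ltnS leq_eqVlt => /predU1P[->|ilt] iS ciy; first by right.
  by left; exists i => //=; rewrite ilt.
rewrite IH; congr f.
apply/seteqP; split => y [i /= /andP[ilt iS] ciy]; exists i => //=.
  by rewrite (ltn_trans ilt).
rewrite iS andbT; move: ilt; rewrite ltnS leq_eqVlt => /predU1P[ni|//].
by move: nS; rewrite -ni iS.
Qed.

Lemma agree_void S n h : agree h (void_pattern S n) <->
  forall i, (i < n)%N -> i \in S -> h i = false.
Proof.
elim: n => [|n IH]; first by split.
rewrite void_patternS /= size_void_pattern; split.
  move=> [hn /IH hi] i; rewrite ltnS leq_eqVlt => /predU1P[-> nS|]; last exact: hi.
  by rewrite nS in hn.
move=> hi; split; first by case: ifPn => // nS; apply: hi.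
by apply/IH => i /ltnW ilt; apply: hi; rewrite ltnS.
Qed.

End void_process.

(** Transport along [pickle]; integers that encode no index get the empty cell, so measurability and
    finiteness persist. *)
Lemma marked_void_process d (Y : measurableType d) (R : realType)
    (m : {measure set Y -> \bar R}) (I : countType) (c : I -> set Y)
    (mc : forall i, measurable (c i)) (coo : forall i, (m (c i) < +oo)%E) :
  exists (P : probability (measurableTypeR R) R) (h : I -> R -> bool),
    (forall i, measurable_fun setT (h i)) /\
    forall S : seq I, P [set x | forall i, i \in S -> h i x = false] =
      (void_prob m (\bigcup_(i in [set` S]) c i))%:E.
Proof.
pose c' n := if unpickle n is Some i then c i else set0.
have mc' n : measurable (c' n) by rewrite /c'; case: unpickle.
have coo' n : (m (c' n) < +oo)%E.
  by rewrite /c'; case: unpickle => //; rewrite measure0.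
have [P [h [mh Ph]]] := void_process_exists mc' coo'.
exists P, (fun i => h (pickle i)); split=> [i|S]; first exact: mh.
pose S' : {pred nat} := mem [seq pickle i | i <- S].
pose n := (\max_(k <- map pickle S) k).+1.
have nS i : i \in S -> (pickle i < n)%N.
  by move=> iS; rewrite ltnS; apply: leq_bigmax_seq => //; exact: map_f.
have -> : [set x | forall i, i \in S -> h (pickle i) x = false] =
    [set x | agree (h^~ x) (void_pattern S' n)].
  apply/seteqP; split => x /=.
    by move=> H; apply/agree_void => k _ /mapP[i iS ->]; exact: H.
  by move=> /agree_void H i iS; apply: H; [exact: nS|exact: map_f].
rewrite Ph pattern_prob_void; congr (void_prob _ _)%:E.
apply/seteqP; split => y.
  by move=> [k /= /andP[_ /mapP[i iS ->]]]; rewrite /c' pickleK => ?; exists i.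
move=> [i /= iS ciy]; exists (pickle i); last by rewrite /c' pickleK.
by rewrite /= nS//=; exact: map_f.
Qed.

(** * Equalities and limits that propagate from a generating class *)

Section dynkin_limits.
Context d (Y : measurableType d) (R : realType) (P : probability Y R).

Lemma probability_unique (P' : probability Y R) (G : set (set Y)) :
  @measurable _ Y = <<s G >> -> setI_closed G ->
  (forall A, G A -> P A = P' A) -> forall A, measurable A -> P A = P' A.
Proof.
move=> GE GI GP A mA.
apply: (@dynkin_induction _ Y G (fun A => P A = P' A) GE GI); rewrite -?GE//.
- by rewrite !probability_setT.
- by move=> S mS PS; rewrite !probability_setC// PS.
- move=> F mF tF PF; rewrite !measure_bigcup//.
  by apply: eq_eseriesr => i _; exact: PF.
Qed.

Definition subcontent (nu : set Y -> R) :=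
  (forall A B, measurable A -> measurable B -> A `&` B = set0 ->
     nu (A `|` B) = nu A + nu B) /\
  (forall A, measurable A -> 0 <= nu A <= fine (P A)).

(** Convergence passes to countable disjoint unions because all [nu t] and the limit are dominated
    by the same [P]: the tail of such a union has small [P]-measure, hence small mass uniformly in
    [t]. The sets where convergence holds thus form a Dynkin class. *)
Lemma cvg_subcontent (T : Type) (F : set_system T) {FF : Filter F}
    (nu : T -> set Y -> R) (nul : set Y -> R) (G : set (set Y)) :
  @measurable _ Y = <<s G >> -> setI_closed G ->
  (forall t, subcontent (nu t)) -> subcontent nul ->
  nu t setT @[t --> F] --> nul setT ->
  (forall A, G A -> nu t A @[t --> F] --> nul A) ->
  forall A, measurable A -> nu t A @[t --> F] --> nul A.
Proof.
move=> GE GI hnu hnul nuT nuG A mA.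
apply: (@dynkin_induction _ Y G (fun A => nu t A @[t --> F] --> nul A) GE GI);
  rewrite -?GE//.
  move=> S mS cS.
  have eC mu : subcontent mu -> mu (~` S) = mu setT - mu S.
    move=> [muD _]; rewrite -(setUv S) muD ?setICr//; last exact: measurableC.
    by rewrite addrAC subrr add0r.
  rewrite eC//; rewrite (_ : (fun t => _) = (fun t => nu t setT - nu t S)).
    exact: cvgB.
  by apply/funext => t; rewrite eC.
move=> B mB tB cB; set U := \bigcup_k B k.
pose V n := \big[setU/set0]_(k < n) B k.
have mV n : measurable (V n) by exact: bigsetU_measurable.
have mU : measurable U by exact: bigcupT_measurable.
have nu0 mu : subcontent mu -> mu set0 = 0.
  move=> [_ /(_ set0 measurable0)]; rewrite measure0 /= => h.
  by apply/eqP; rewrite eq_le andbC.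
have cV n : nu t (V n) @[t --> F] --> nul (V n).
  elim: n => [|n IH].
    rewrite /V big_ord0 (nu0 _ hnul) (_ : (fun t => _) = fun=> 0); first exact: cvg_cst.
    by apply/funext => t; rewrite nu0.
  have disj : V n `&` B n = set0.
    rewrite /V setIC big_distrr/=; apply: big1 => i _.
    have /trivIsetP/(_ n i I I) := tB; apply; by rewrite eq_sym ltn_eqF.
  have VS mu : subcontent mu -> mu (V n.+1) = mu (V n) + mu (B n).
    by move=> [muD _]; rewrite /V big_ord_recr/= muD//; exact: mV.
  rewrite VS// (_ : (fun t => _) = fun t => nu t (V n) + nu t (B n)); first exact: cvgD.
  by apply/funext => t; rewrite VS.
have VU n : V n `<=` U by rewrite /V -bigcup_mkord; exact: bigcup_sub_bigcup || by move=> y [k _ By]; exists k.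
have UE : U = \bigcup_n V n.
  apply/seteqP; split => y [k _]; last exact: VU.
  by move=> By; exists k.+1 => //; rewrite /V -bigcup_mkord; exists k => /=.
apply/cvgrPdist_le => e e0.
have e3 : 0 < e / 3 by rewrite divr_gt0.
have [n Pn] : exists n, fine (P (U `\` V n)) <= e / 3.
  have : fine (P (V n)) @[n --> \oo] --> fine (P U).
    apply: fine_cvg; rewrite fineK ?fin_num_measure//.
    rewrite [X in P X]UE; apply: (@nondecreasing_cvg_mu _ _ _ P V) => //.
      by rewrite -UE.
    by apply/nondecreasing_seqP => k; apply/subsetPset; rewrite /V big_ord_recr/=; exact: subsetUl.
  move=> /cvgrPdist_le/(_ _ e3)[n _ /(_ n (leqnn n)) /= h]; exists n.
  rewrite measureD//; last by rewrite ltey_eq fin_num_measure.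
  rewrite (setIidr (VU n)) fineB ?fin_num_measure//.
  exact: le_trans (ler_norm _) h.
near=> t.
have split3 mu : subcontent mu -> mu U = mu (V n) + mu (U `\` V n).
  move=> [muD _]; rewrite -muD// ?setDUK//; first exact: measurableD.
  by rewrite setDE setICA setICr setI0.
have bnd mu : subcontent mu -> 0 <= mu (U `\` V n) <= e / 3.
  move=> [_ /(_ (U `\` V n) (measurableD mU (mV n)))] /andP[-> h].
  exact: le_trans h Pn.
rewrite !split3// opprD addrACA.
have -> : e = e / 3 + (e / 3 + e / 3) by lra.
apply: (le_trans (ler_normD _ _)); apply: lerD.
  by near: t; move/cvgrPdist_le : (cV n); apply.
rewrite ler_norml; have := bnd _ hnul; have := bnd _ (hnu t).
move=> /andP[? ?] /andP[? ?]; apply/andP; split; lra.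
Unshelve. all: by end_near. Qed.

End dynkin_limits.

Lemma lebesgue_measure_shift (R : realType) (t : R) (A : set R) : measurable A ->
  lebesgue_measure ((fun x => x + t) @^-1` A) = lebesgue_measure A.
Proof.
pose f (x : measurableTypeR R) : measurableTypeR R := x + t.
have mt : measurable_fun setT f by exact: measurable_funD.
move=> mA; rewrite -[LHS]/(pushforward (@lebesgue_measure R) f A).
apply/esym/lebesgue_measure_unique => // _ [[a b]] _ <-.
rewrite /= /pushforward (_ : f @^-1` _ = `]a - t, b - t]%classic); last first.
  by apply/seteqP; split => x /=; rewrite !in_itv/= lerBrDr ltrBlDr.
rewrite !lebesgue_measure_itv/= !lte_fin ltrD2r; case: ifP => // _.
by congr EFin; lra.
Qed.

Lemma image_probability d d' (Y : measurableType d) (Z : measurableType d')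
    (R : realType) (P : probability Y R) (f : Y -> Z) : measurable_fun setT f ->
  exists Q : probability Z R, forall A, Q A = P (f @^-1` A).
Proof.
move=> mf; pose g : {mfun Y >-> Z} := HB.pack f (isMeasurableFun.Build _ _ _ _ _ mf).
by exists (distribution P g).
Qed.

(** * Poisson noise with countably many marks and its rational translations *)

Section noise.
Context (R : realType) (lam : nat -> {nonneg R}).

Definition mark_slice (n : nat) : {measure set (nat * measurableTypeR R) -> \bar R}.
Proof.
by refine (pushforward (@lebesgue_measure R) (pair n)); exact: pair1_measurable.
Defined.

(* The points of mark [n] have intensity [lam n]. *)
Definition mark_measure : set (nat * measurableTypeR R) -> \bar R :=
  mseries (fun n => mscale (lam n) (mark_slice n)) 0.

HB.instance Definition _ := Measure.on mark_measure.

Lemma mark_measureE A :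
  mark_measure A = (\sum_(0 <= n <oo) (lam n)%:num%:E * lebesgue_measure [set x | A (n, x)])%E.
Proof. by []. Qed.

Definition cell_index : countType := (nat * (rat * rat))%type.

Definition cell (i : cell_index) : set (nat * measurableTypeR R) :=
  [set i.1] `*` `[ratr i.2.1 : R, ratr i.2.2[%classic.

(* [w (n, (a, b))] tells whether [a, b[ contains a point of mark [n]. *)
Definition configuration : Type := cell_index -> bool.
HB.instance Definition _ := Pointed.on configuration.

Definition void (S : seq cell_index) : set configuration :=
  [set w | forall i, i \in S -> w i = false].

Definition noise := g_sigma_algebraType (range void).

Lemma measurable_cell i : measurable (cell i).
Proof. by apply: measurableX => //; exact: measurable_itv. Qed.

Lemma mark_measure_section n (B : set R) : measurable B ->
  mark_measure ([set n] `*` B) = ((lam n)%:num%:E * lebesgue_measure B)%E.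
Proof.
move=> mB; rewrite mark_measureE.
rewrite (nneseriesD1 (n := n))//; last by move=> k _; rewrite mule_ge0// lee_fin.
rewrite eseries0 ?adde0; last first.
  move=> k _ kn; rewrite (_ : [set x | _] = set0) ?measure0 ?mule0//.
  by apply/seteqP; split => x //= [/= kn']; move: kn; rewrite kn' eqxx.
congr (_ * lebesgue_measure _)%E.
by apply/seteqP; split => x //= [].
Qed.

Lemma mark_measure_cell i : mark_measure (cell i) =
  ((lam i.1)%:num * Num.max 0 (ratr i.2.2 - ratr i.2.1))%:E.
Proof.
rewrite mark_measure_section; last exact: measurable_itv.
set a := ratr i.2.1; set b := ratr i.2.2.
rewrite lebesgue_measure_itv/= lte_fin [RHS]EFinM; congr (_ * _)%E.
case: ltP => h; first by rewrite -EFinD max_r// subr_ge0 ltW.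
by rewrite max_l// subr_le0.
Qed.

(** The bits of [marked_void_process] are functions on an auxiliary probability space without
    translations; the law is moved to the space of configurations, where [noise_shift] acts. *)
Lemma noise_exists : exists Q : probability noise R,
  forall S, Q (void S) = (void_prob mark_measure (\bigcup_(i in [set` S]) cell i))%:E.
Proof.
have [|P [h [mh Ph]]] := marked_void_process (m := mark_measure) measurable_cell.
  by move=> i; rewrite -[X in (X < _)%E]/(mark_measure (cell i)) mark_measure_cell ltry.
pose H x : noise := fun i => h i x.
have mH : measurable_fun setT H.
  apply: (@measurability _ _ (measurableTypeR R) noise setT H (range void)) => //.
  move=> _ [_ [S _ <-] <-]; rewrite setTI.
  elim: S => [|i S IH].
    by rewrite (_ : _ @^-1` _ = setT)//; apply/seteqP; split => // x _ i.
  rewrite (_ : _ @^-1` _ = h i @^-1` [set false] `&` H @^-1` (void S)).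
    by apply: measurableI => //; rewrite -[X in measurable X]setTI; exact: mh.
  apply/seteqP; split => x /=.
    move=> vS; split; first by apply: vS; rewrite mem_head.
    by move=> j jS; apply: vS; rewrite inE jS orbT.
  by move=> [hi vS] j; rewrite inE => /predU1P[->//|/vS].
have [Q HQ] := image_probability P mH.
by exists Q => S; rewrite HQ -Ph.
Qed.

(** Points move by [t] to the right: [a, b[ is hit after the shift when [a - t, b - t[ was hit
    before. The time is rational so that the new endpoints are again indices. *)
Definition noise_shift (t : rat) (w : noise) : noise :=
  fun i => w (i.1, (i.2.1 - t, i.2.2 - t)).

Definition shift_cells (t : rat) (S : seq cell_index) : seq cell_index :=
  [seq (i.1, (i.2.1 - t, i.2.2 - t)) | i <- S].

Lemma preimage_void_shift t S :
  noise_shift t @^-1` (void S) = void (shift_cells t S).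
Proof.
apply/seteqP; split => w /=.
  by move=> vS _ /mapP[i iS ->]; exact: vS.
by move=> vS i iS; apply: vS; apply/mapP; exists i.
Qed.

Lemma setI_closed_void : setI_closed (range void).
Proof.
move=> _ _ [S _ <-] [S' _ <-]; exists (S ++ S') => //.
apply/seteqP; split => w /=.
  by move=> vS; split => i iS; apply: vS; rewrite mem_cat iS ?orbT.
by move=> [v v'] i; rewrite mem_cat => /orP[/v|/v'].
Qed.

Lemma measurable_void S : measurable (void S : set noise).
Proof. by apply: sub_sigma_algebra; exists S. Qed.

Lemma measurable_noise_shift t : measurable_fun setT (noise_shift t).
Proof.
apply: (@measurability _ _ noise noise setT _ (range void)) => //.
move=> _ [_ [S _ <-] <-]; rewrite setTI preimage_void_shift.
exact: measurable_void.
Qed.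

Lemma measurable_cells_bigcup (S : seq cell_index) :
  measurable (\bigcup_(i in [set` S]) cell i).
Proof.
by apply: fin_bigcup_measurable => // i _; exact: measurable_cell.
Qed.

Lemma mark_measure_shift t S :
  mark_measure (\bigcup_(i in [set` shift_cells t S]) cell i) =
  mark_measure (\bigcup_(i in [set` S]) cell i).
Proof.
rewrite !mark_measureE; apply: eq_eseriesr => n _; congr (_ * _)%E.
rewrite -(lebesgue_measure_shift (- ratr t)); last first.
  have := @pair1_measurable _ _ nat (measurableTypeR R) n measurableT _
    (measurable_cells_bigcup (shift_cells t S)).
  by rewrite setTI => h; exact: h.
congr lebesgue_measure; apply/seteqP; split => x /=.
  move=> [_ /= /mapP[i iS ->] [/= ni xi]]; exists i => //; split => //=.
  move: xi; rewrite !in_itv/= !rmorphB/=; lra.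
move=> [i /= iS [/= ni xi]]; exists (i.1, (i.2.1 - t, i.2.2 - t)).
  by apply/mapP; exists i.
split => //=; move: xi; rewrite !in_itv/= !rmorphB/=; lra.
Qed.

Section law.
Variable Q : probability noise R.
Hypothesis QE : forall S, Q (void S) =
  (void_prob mark_measure (\bigcup_(i in [set` S]) cell i))%:E.

Lemma noise_shift_invariant t A : measurable A ->
  Q (noise_shift t @^-1` A) = Q A.
Proof.
move=> mA; have [Q' HQ'] := image_probability Q (measurable_noise_shift t).
rewrite -HQ'; apply: (@probability_unique _ noise _ _ _ (range void)) => //.
  exact: setI_closed_void.
move=> _ [S _ <-]; rewrite HQ' preimage_void_shift !QE /void_prob.
congr (expR (- fine _))%:E; exact: mark_measure_shift.
Qed.

Lemma mark_measure_cells_lty (S : seq cell_index) :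
  (mark_measure (\bigcup_(i in [set` S]) cell i) < +oo)%E.
Proof.
elim: S => [|i S IH].
  by rewrite (_ : \bigcup_(_ in _) _ = set0) ?measure0// bigcup0.
have -> : [set` i :: S] = i |` [set` S].
  by apply/seteqP; split => j /=; rewrite inE => /predU1P.
rewrite bigcup_setU1.
apply: (@le_lt_trans _ _ (mark_measure (cell i) +
   mark_measure (\bigcup_(i in [set` S]) cell i))%E).
  by apply: measureU2; [exact: measurable_cell|exact: measurable_cells_bigcup].
by rewrite lte_add_pinfty// mark_measure_cell ltry.
Qed.

(** On disjoint unions of cells the mass is additive, and [expR] turns the sum into a product. *)
Lemma void_independent (S S' : seq cell_index) :
  (\bigcup_(i in [set` S]) cell i) `&` (\bigcup_(i in [set` S']) cell i) = set0 ->
  Q (void S `&` void S') = (Q (void S) * Q (void S'))%E.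
Proof.
move=> SS'; rewrite (_ : void S `&` void S' = void (S ++ S')); last first.
  apply/seteqP; split => w /=.
    by move=> [v v'] i; rewrite mem_cat => /orP[/v|/v'].
  by move=> vS; split => i iS; apply: vS; rewrite mem_cat iS ?orbT.
rewrite !QE -EFinM /void_prob -expRD; congr (expR _)%:E.
have -> : [set` S ++ S'] = [set` S] `|` [set` S'].
  by apply/seteqP; split => i /=; rewrite mem_cat => /orP.
rewrite bigcup_setU measureU//; try exact: measurable_cells_bigcup.
rewrite fineD ?opprD// ge0_fin_numE//; exact: mark_measure_cells_lty.
Qed.

(** Not only a limit: once the finitely many cells of [S'], moved left by [t], lie before those of
    [S], independence is exact. [M] is the largest right end in [S'] minus the smallest left end in
    [S]; the default 0 of the two extrema can only enlarge it. *)
Lemma void_mixing (S S' : seq cell_index) : exists M : rat, forall t, M <= t ->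
  Q (void S `&` noise_shift t @^-1` (void S')) = (Q (void S) * Q (void S'))%E.
Proof.
have [M HM] : exists M : rat, forall i j t, i \in S -> j \in S' -> M <= t ->
    j.2.2 - t <= i.2.1.
  pose a := \big[Order.min/0]_(i <- S) i.2.1.
  pose b := \big[Order.max/0]_(j <- S') j.2.2.
  exists (b - a) => i j t iS jS ht.
  have ai : a <= i.2.1 by apply: ge_bigmin_seq iS _.
  have bj : j.2.2 <= b by apply: le_bigmax_seq jS _.
  lra.
exists M => t Mt; rewrite preimage_void_shift void_independent; last first.
  apply/seteqP; split => // -[n x] [[i /= iS [/= ni xi]] [_ /= /mapP[j jS ->] [/= nj xj]]].
  have := HM _ _ _ iS jS Mt; rewrite -(ler_rat R).
  move: xi xj; rewrite !in_itv/= => /andP[? _] /andP[_ ?].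
  by move=> h; have : ratr (j.2.2 - t) <= x; [lra|rewrite leNgt => /negP].
congr (_ * _)%E; rewrite -preimage_void_shift noise_shift_invariant//.
exact: measurable_void.
Qed.

(** [cvg_subcontent] is applied twice, first in [B] for a void event in place of [A], then in [A].
    Domination by [Q] is plain monotonicity in [A]; in [B] it comes from the invariance of [Q] under
    the shift. *)
Lemma noise_mixing (A B : set noise) : measurable A -> measurable B ->
  fine (Q (A `&` noise_shift t @^-1` B)) @[t --> (+oo : set_system rat)] -->
  fine (Q A) * fine (Q B).
Proof.
have mI C D t : measurable C -> measurable D ->
    measurable (C `&` noise_shift t @^-1` D).
  move=> mC mD; apply: measurableI => //; rewrite -[X in measurable X]setTI.
  exact: measurable_noise_shift.
have QU C D : measurable C -> measurable D -> C `&` D = set0 ->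
    fine (Q (C `|` D)) = fine (Q C) + fine (Q D).
  by move=> mC mD CD; rewrite measureU// fineD ?fin_num_measure.
have Q1 C : measurable C -> 0 <= fine (Q C) <= 1.
  move=> mC; rewrite fine_ge0//= -lee_fin fineK ?fin_num_measure//.
  exact: probability_le1.
have leQ C D : measurable C -> measurable D -> C `<=` D -> fine (Q C) <= fine (Q D).
  by move=> mC mD CD; rewrite fine_le ?fin_num_measure// le_measure ?inE.
move=> + mB.
have sub2 C : measurable C -> subcontent Q (fun D => fine (Q C) * fine (Q D)).
  move=> mC; split => [D E mD mE DE|D mD]; first by rewrite QU// mulrDr.
  have /andP[? ?] := Q1 _ mC; have /andP[? ?] := Q1 _ mD.
  by rewrite mulr_ge0// ler_piMl.
have step S : fine (Q (void S `&` noise_shift t @^-1` B)) @[t --> (+oo : set_system rat)] -->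
  fine (Q (void S)) * fine (Q B).
  have mS := measurable_void S.
  apply: (@cvg_subcontent _ noise R Q rat _ _
    (fun t D => fine (Q (void S `&` noise_shift t @^-1` D)))
    (fun D => fine (Q (void S)) * fine (Q D)) (range void)) => //.
  - exact: setI_closed_void.
  - move=> t; split => [D E mD mE DE|D mD].
      rewrite preimage_setU setIUr QU//; [exact: mI|exact: mI|].
      by rewrite setIACA setIid -preimage_setI DE preimage_set0 setI0.
    rewrite fine_ge0//= -(noise_shift_invariant t mD) leQ//; first exact: mI.
    by rewrite -[X in measurable X]setTI; exact: measurable_noise_shift.
  - exact: sub2.
  - rewrite probability_setT mulr1 (_ : (fun t => _) = fun=> fine (Q (void S))).
      exact: cvg_cst.
    by apply/funext => t; rewrite preimage_setT setIT.
  - move=> _ [S' _ <-]; have [M HM] := void_mixing S S'.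
    apply: cvg_near_cst; exists M; split; first exact: num_real.
    by move=> t /ltW /HM ->; rewrite fineM ?fin_num_measure//; exact: measurable_void.
move=> mA; apply: (@cvg_subcontent _ noise R Q rat _ _
    (fun t D => fine (Q (D `&` noise_shift t @^-1` B)))
    (fun D => fine (Q D) * fine (Q B)) (range void)) => //.
- exact: setI_closed_void.
- move=> t; split => [D E mD mE DE|D mD].
    rewrite setIUl QU//; [exact: mI|exact: mI|].
    by rewrite setIACA DE set0I.
  by rewrite fine_ge0//= leQ//; exact: mI.
- have [h1 h2] := sub2 _ mB; split => [D E mD mE DE|D mD].
    by rewrite ![_ * fine (Q B)]mulrC h1.
  by rewrite mulrC h2.
- rewrite probability_setT mul1r (_ : (fun t => _) = fun=> fine (Q B)).
    exact: cvg_cst.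
  by apply/funext => t; rewrite setTI noise_shift_invariant.
- by move=> _ [S _ <-]; exact: step.
Qed.

End law.

End noise.

(** * Pettis integrals over subsets of the real line *)

Section hahn_banach.
Context (R : realType) (X : normedModType R).

(* Partial functionals dominated by the norm are encoded by their graphs;
   domination and linearity make such a graph single-valued. *)
Let dominated_graph (G : set (X * R)) :=
  (forall (k : R) x a y b, G (x, a) -> G (y, b) -> G (k *: x + y, k * a + b)) /\
  (forall x a, G (x, a) -> a <= `|x|).

(** The one-dimensional step of Hahn-Banach. The value at [y0] must lie above every [b - |z - y0|]
    and below every [|x + y0| - a] with (z, b) and (x, a) in [G]; the triangle inequality makes
    these bounds compatible, and the supremum of the former is taken. Dividing by the absolute value
    of [k] reduces domination to coefficients 1 and -1. *)
Let dominated_ext (G : set (X * R)) (y0 : X) : G (0, 0) -> dominated_graph G ->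
  exists c : R, dominated_graph
    [set p | exists x a k, G (x, a) /\ p = (x + k *: y0, a + k * c)].
Proof.
move=> G0 [Gl Gb].
pose A := [set q.2 - `|q.1 - y0| | q in G].
have Aub x a : G (x, a) -> ubound A (`|x + y0| - a).
  move=> Gp _ [[z b] /= Gq <-]; rewrite lerBlDr addrAC lerBrDl.
  have := Gb _ _ (Gl 1 _ _ _ _ Gp Gq); rewrite /= mul1r scale1r => /le_trans; apply.
  have -> : x + z = (x + y0) + (z - y0) by rewrite addrACA subrr addr0.
  exact: ler_normD.
have supA : has_sup A.
  split; [exists (0 - `|0 - y0|); exists (0,0) => //|exists (`|0 + y0| - 0); exact: Aub].
pose c := sup A.
have Hup x a : G (x, a) -> a + c <= `|x + y0|.
  by move=> /Aub /(ge_sup supA.1); rewrite lerBrDl.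
have Hlo x a : G (x, a) -> a - c <= `|x - y0|.
  move=> Gx; rewrite lerBlDr -lerBlDl; apply: ub_le_sup; first exact: supA.2.
  by exists (x, a).
have Gz (z : R) x a : G (x, a) -> G (z *: x, z * a).
  by move=> Gx; have := Gl z x a 0 0 Gx G0; rewrite !addr0.
exists c; split => [k _ _ _ _ [x [a [k1 [Gx [-> ->]]]]] [y [b [k2 [Gy [-> ->]]]]]|].
  exists (k *: x + y), (k * a + b), (k * k1 + k2); split; first exact: Gl.
  congr pair; first by rewrite scalerDr scalerDl addrACA scalerA.
  by rewrite mulrDr mulrDl addrACA mulrA.
move=> _ _ [x [a [k [Gx [-> ->]]]]].
have [k0|k0|->] := ltgtP k 0; last by rewrite scale0r addr0 mul0r addr0; exact: Gb.
  have nk : 0 < - k by rewrite oppr_gt0.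
  have := Hlo _ _ (Gz (- k)^-1 _ _ Gx).
  rewrite -(ler_pM2l nk) mulrBr mulrA mulfV ?gt_eqF// mul1r mulNr opprK.
  move=> /le_trans; apply.
  rewrite -[X in X * _](gtr0_norm nk) -normrZ scalerBr scalerA mulfV ?gt_eqF//.
  by rewrite scale1r scaleNr opprK.
have := Hup _ _ (Gz k^-1 _ _ Gx).
rewrite -(ler_pM2l k0) mulrDr mulrA mulfV ?gt_eqF// mul1r.
move=> /le_trans; apply.
by rewrite -[X in X * _](gtr0_norm k0) -normrZ scalerDr scalerA mulfV ?gt_eqF// scale1r.
Qed.

Lemma norming_functional (x0 : X) : exists phi : {linear X -> R^o},
  (forall x, `|phi x| <= `|x|) /\ phi x0 = `|x0|.
Proof.
pose L := [set p : X * R | exists k : R, p = (k *: x0, k * `|x0|)].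
(* Putting [L] into the constraint makes the maximal graph carry the value prescribed at [x0], while
   the empty chain still has an admissible union. *)
have [G [[Gl Gb] Gmax]] : exists G, dominated_graph (G `|` L) /\
    forall B, G `<` B -> ~ dominated_graph (B `|` L).
  apply: (@Zorn_bigcup _ [set G | dominated_graph (G `|` L)]) => F FP Ftot.
  have bigE B p : F B -> (B `|` L) p -> (\bigcup_(X0 in F) X0 `|` L) p.
    by move=> FB [Bp|Lp]; [left; exists B|right].
  have LP : dominated_graph L.
    split=> [k _ _ _ _ [a [-> ->]] [b [-> ->]]|_ _ [k [-> ->]]].
      by exists (k * a + b); rewrite !scalerDl !scalerA mulrDl mulrA.
    by rewrite normrZ ler_wpM2r// ler_norm.
  split=> [k x a y b|x a].
    move=> [[A FA Ax]|Lx] [[B FB By]|Ly].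
    - have [AB|BA] := Ftot _ _ FA FB.
        by apply: (bigE _ _ FB); apply: (FP _ FB).1; left => //; exact: AB.
      by apply: (bigE _ _ FA); apply: (FP _ FA).1; left => //; exact: BA.
    - by apply: (bigE _ _ FA); apply: (FP _ FA).1; [left|right].
    - by apply: (bigE _ _ FB); apply: (FP _ FB).1; [right|left].
    - by right; apply: LP.1.
  by move=> [[A FA Ax]|Lx]; [apply: (FP _ FA).2; left|exact: LP.2].
set H := G `|` L in Gl Gb.
have HL : L `<=` H by move=> p; right.
have H0 : H (0, 0) by apply: HL; exists 0; rewrite scale0r mul0r.
have Hx0 : H (x0, `|x0|) by apply: HL; exists 1; rewrite scale1r mul1r.
have Htot y : exists a, H (y, a).
  apply: contrapT => nHy.
  have [c Hc] := dominated_ext y H0 (conj Gl Gb).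
  set B := [set p | _] in Hc.
  have HB : H `<=` B by move=> [x a] Hx; exists x, a, 0; rewrite scale0r mul0r !addr0.
  apply: (Gmax B); last first.
    suff -> : B `|` L = B by [].
    by apply/setUidPl; exact: subset_trans HB.
  split; first by move=> p Gp; apply: HB; left.
  move=> /(_ (y, c)) BG; apply: nHy; exists c; left; apply: BG.
  by exists 0, 0, 1; rewrite !add0r scale1r mul1r.
have Hfun x a b : H (x, a) -> H (x, b) -> a = b.
  move=> Ha Hb; apply/eqP; rewrite eq_le; apply/andP; split.
    have := Gb _ _ (Gl (-1) _ _ _ _ Hb Ha).
    by rewrite scaleN1r addNr normr0 mulN1r addrC subr_le0.
  have := Gb _ _ (Gl (-1) _ _ _ _ Ha Hb).
  by rewrite scaleN1r addNr normr0 mulN1r addrC subr_le0.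
have [f Hf] := choice Htot.
have lf : linear (f : X -> R^o).
  by move=> k x y; apply: Hfun (Hf _) _; exact: Gl.
pose lfm := GRing.isLinear.Build R X R^o _ f lf.
pose phi : {linear X -> R^o} := HB.pack f lfm.
exists phi; split => [x|]; last exact: Hfun (Hf _) Hx0.
rewrite ler_norml; apply/andP; split; last exact: (Gb _ _ (Hf x)).
rewrite lerNl -normrN.
have := Gb _ _ (Gl (-1) _ _ _ _ (Hf x) H0).
by rewrite scaleN1r !addr0 mulN1r.
Qed.
End hahn_banach.

(** * Pettis integrals over Borel sets of times *)

Section line_pettis.
Context (R : realType).
Local Notation leb := (@lebesgue_measure R).
Local Notation RT := (measurableTypeR R).

Lemma integrable_tail (f : RT -> R) (e : R) : leb.-integrable setT (EFin \o f) ->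
  0 < e -> exists M : R, 0 < M /\ forall E : set RT, measurable E ->
    E `&` `[-M, M] = set0 -> `|\int[leb]_(t in E) f t| <= e.
Proof.
move=> fi e0.
pose g n x := `|f x| * \1_(~` `[- n.+1%:R, n.+1%:R]) x.
have mf : measurable_fun setT f.
  by have /integrableP[/measurable_EFinP] := fi.
have nfi : leb.-integrable setT (EFin \o (fun x => `|f x|)).
  exact: integrable_norm.
have mg n : measurable_fun setT (EFin \o g n).
  apply/measurable_EFinP/measurable_funM; first exact: measurableT_comp.
  by apply: measurable_indic; apply: measurableC; exact: measurable_itv.
have gle n x : (`|(EFin \o g n) x| <= (`|f x|)%:E)%E.
  rewrite /g lee_fin normrM normr_id ler_piMr// ger0_norm ?indicE//.
  by case: (x \in _).
have gi n : leb.-integrable setT (EFin \o g n).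
  apply: (@le_integrable _ _ R leb setT measurableT _ (EFin \o (fun x => `|f x|))); [exact: mg| |exact: nfi].
  move=> x _; apply: le_trans (gle n x) _.
  by rewrite /= lee_fin normr_id.
have g0 x : setT x -> (EFin \o g n) x @[n --> \oo] --> (cst 0%E) x.
  move=> _; apply: cvg_near_cst.
  have [k kx] : exists k : nat, `|x| <= k.+1%:R.
    exists (Num.truncn `|x|); exact: ltW (truncnS_gt _).
  exists k => // n /= kn; rewrite /g indicE memNset ?mulr0//=.
  apply; rewrite in_itv/= -ler_norml (le_trans kx)// ler_nat ltnS.
  exact: kn.
have := @dominated_cvg _ _ R leb setT measurableT (fun n => EFin \o g n) (cst 0%E) _ mg g0 _ nfi (fun n x _ => gle n x).
rewrite integral0 => /(_ (fun _ _ => isT)) /fine_cvgP[_] /cvgrPdist_le /(_ _ e0)[n _ /(_ n (leqnn n))] /=.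
rewrite sub0r normrN => hn.
exists n.+1%:R; split => // E mE EM.
have fiE : leb.-integrable E (EFin \o f) by exact: integrableS fi.
apply: (le_trans (le_normr_Rintegral mE fiE)).
apply: (le_trans _ (le_trans (ler_norm _) hn)).
rewrite Rintegral_mkcond; apply: le_Rintegral => //.
  rewrite -restrict_EFin; apply: (proj1 (integrable_mkcond _ mE)).
  exact: integrable_norm.
move=> x _; rewrite /g patchE; case: ifPn => [|_]; last by rewrite mulr_ge0.
rewrite inE => xE; rewrite indicE mem_set ?mulr1// => /= xM.
by have : set0 x by rewrite -EM.
Qed.

Lemma normr_cst_Rintegral_le (f : RT -> R) (E : set RT) (K : R) : measurable E ->
  leb.-integrable E (EFin \o f) -> (leb E < +oo)%E ->
  (forall x, E x -> `|f x| <= K) ->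
  `|\int[leb]_(t in E) f t| <= K * fine (leb E).
Proof.
move=> mE fi Eoo fK; apply: le_trans (le_normr_Rintegral mE fi) _.
rewrite -Rintegral_cst//; apply: le_Rintegral => //.
  exact: integrable_norm.
apply: measurable_bounded_integrable => //.
exists `|K|; split; rewrite ?num_real// => r Kr x _ /=; exact: ltW.
Qed.

Definition pettis_value (X : normedModType R) (u : R -> X) (E : set RT) (x : X) :=
  forall phi : {linear X -> R^o}, continuous phi ->
    phi x = \int[leb]_(t in E) phi (u t).

(** Borel sets and the uncompleted Lebesgue measure are the right setting here: the random sets of
    times will be sections of product-measurable sets, and such sections are Borel. *)
Definition line_pettis (X : normedModType R) (u : R -> X) :=
  (forall phi : {linear X -> R^o}, continuous phi ->
    leb.-integrable setT (EFin \o (phi \o u))) /\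
  (forall E : set RT, measurable E -> exists x, pettis_value u E x).

Section pettis_integral.
Context (X : normedModType R).
Implicit Types (phi : {linear X -> R^o}) (x : X).

Lemma contractive_continuous phi : (forall x, `|phi x| <= `|x|) -> continuous phi.
Proof.
move=> phi1; apply: bounded_linear_continuous.
apply/linear_boundedP; exists 1; split => // r r1 x.
by apply: le_trans (phi1 x) _; rewrite ler_peMl// ltW.
Qed.

Lemma functional_separates x y :
  (forall phi, continuous phi -> phi x = phi y) -> x = y.
Proof.
move=> xy; have [phi [phi1 phixy]] := norming_functional (x - y).
apply/eqP; rewrite -subr_eq0 -normr_eq0 -phixy linearB (xy phi) ?subrr//.
exact: contractive_continuous.
Qed.

Lemma norm_le_functional x (K : R) :
  (forall phi, (forall y, `|phi y| <= `|y|) -> phi x <= K) -> `|x| <= K.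
Proof. by move=> h; have [phi [phi1 <-]] := norming_functional x; exact: h. Qed.

Lemma separable_seq : separable X ->
  exists d : nat -> X, forall x (e : R), 0 < e -> exists i, `|x - d i| < e.
Proof.
move=> [D cD dD].
have /pfcard_geP[De|[d]] : (D #<= [set: nat])%card by [].
  by have [x []] := dD setT (ex_intro _ 0 I) openT; rewrite De.
exists d => x e e0; have [||y [xy Dy]] := dD (ball x e).
- by exists x; apply: ballxx.
- exact: ball_open.
- have [i _ diy] := 'surj_d Dy.
  by exists i; rewrite diy; move: xy; rewrite -ball_normE/=.
Qed.

Variable u : R -> X.
Hypothesis pu : line_pettis u.

Definition pettis_int (E : set RT) : X := xget 0 (pettis_value u E).

Lemma pettis_intP (E : set RT) phi : measurable E -> continuous phi ->
  phi (pettis_int E) = \int[leb]_(t in E) phi (u t).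
Proof.
move=> mE cphi; have [x xE] := pu.2 _ mE.
by have := xgetI 0 xE; apply.
Qed.

Lemma pettis_integrable_on phi (E : set RT) : continuous phi -> measurable E ->
  leb.-integrable E (EFin \o (phi \o u)).
Proof. by move=> cphi mE; apply: integrableS (pu.1 _ cphi). Qed.

Lemma pettis_intU (E F : set RT) : measurable E -> measurable F -> E `&` F = set0 ->
  pettis_int (E `|` F) = pettis_int E + pettis_int F.
Proof.
move=> mE mF EF; apply: functional_separates => phi cphi.
rewrite linearD !pettis_intP//; last exact: measurableU.
rewrite Rintegral_setU//; last exact/disj_set2P.
by apply: pettis_integrable_on => //; exact: measurableU.
Qed.

(* A form of the Orlicz-Pettis theorem. If it failed, a set [E] could be built,
   window after window, so that its integral avoids each of countably many
   balls covering [X]: at each step one of [F] and [F `|` E'] has an integral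
   outside the next ball, and a functional separating it from that ball only
   sees a bounded window up to a small error. *)
Lemma pettis_int_tail : separable X -> forall e : R, 0 < e ->
  exists M : R, 0 < M /\ forall E : set RT, measurable E ->
    E `&` `[-M, M] = set0 -> `|pettis_int E| <= e.
Proof.
move=> sepX e e0; apply: contrapT => nM.
have [d dX] := separable_seq sepX.
have Dd x : exists i, `|x - d i| <= e / 2.
  have [|i /ltW] := dX x (e / 2); first by rewrite divr_gt0.
  by exists i.
have bad M : 0 < M -> exists E : set RT, [/\ measurable E, E `&` `[-M, M] = set0 & e < `|pettis_int E|].
  move=> M0; apply: contrapT => nE; apply: nM; exists M; split => // E mE EM.
  by rewrite leNgt; apply/negP => eE; apply: nE; exists E.
pose ok (p : set RT * R) := [/\ measurable p.1, p.1 `<=` `[- p.2, p.2] & 0 < p.2].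
have step i (p : set RT * R) : ok p -> exists p' : set RT * R, [/\ ok p', p.2 + 1 <= p'.2,
    p'.1 `&` `[- p.2, p.2] = p.1 &
    forall E : set RT, measurable E -> E `&` `[- p'.2, p'.2] = p'.1 -> e / 2 < `|pettis_int E - d i|].
  case: p => F M [/= mF FM M0].
  have [E' [mE' E'M eE']] := bad _ M0.
  have [G [mG GM eG]] : exists G : set RT, [/\ measurable G, G `&` `[- M, M] = F & e / 2 < `|pettis_int G - d i|].
    have [h|h] := ltP (e / 2) `|pettis_int F - d i|.
      by exists F; split => //; exact/setIidPl.
    exists (F `|` E'); split; first exact: measurableU.
      by rewrite setIUl E'M setU0; exact/setIidPl.
    have FE' : F `&` E' = set0.
      apply/seteqP; split => // t [Ft E't]; rewrite -E'M; split => //; exact: FM.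
    rewrite pettis_intU// addrAC addrC -[X in _ < `|_ + X|]opprK.
    rewrite (lt_le_trans _ (lerB_dist _ _))// normrN.
    by lra.
  have [phi [phi1 phiG]] := norming_functional (pettis_int G - d i).
  have cphi := contractive_continuous phi1.
  (* A third of the excess over [e / 2]: outside the window [M2], [phi] sees at most [eta] of [G]
     and at most [eta] of any competitor [E], so [2 * eta] must fit into the excess. *)
  have [eta eta0 etaG] : exists2 eta, 0 < eta & e / 2 + 2 * eta < `|pettis_int G - d i|.
    by exists ((`|pettis_int G - d i| - e / 2) / 3); lra.
  have [M' [M'0 hM']] := integrable_tail (pu.1 _ cphi) eta0.
  pose M2 := Num.max M' (M + 1).
  have MM2 : M + 1 <= M2 by rewrite le_max lexx orbT.
  have M'M2 : M' <= M2 by rewrite le_max lexx.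
  have mK (r : R) : measurable (`[- r, r]%classic : set RT) by exact: measurable_itv.
  exists (G `&` `[- M2, M2], M2); split => //=.
  - split => /=; [exact: measurableI|exact: subIsetr|lra].
  - rewrite -GM -setIA; congr (_ `&` _); apply/setIidPr => t /=.
    by rewrite !in_itv/= => /andP[? ?]; apply/andP; split; lra.
  move=> E mE EG.
  have split_int A : measurable A -> phi (pettis_int A) =
      phi (pettis_int (A `&` `[- M2, M2])) + \int[leb]_(t in A `\` `[- M2, M2]) phi (u t).
    move=> mA; rewrite -(pettis_intP (measurableD mA (mK M2)) cphi) -linearD -pettis_intU.
    - by rewrite setUIDK.
    - exact: measurableI.
    - exact: measurableD.
    - by rewrite setDE setIACA setICr setI0.
  have tail A : measurable A -> `|\int[leb]_(t in A `\` `[- M2, M2]) phi (u t)| <= eta.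
    move=> mA; apply: hM'; first exact: measurableD.
    apply/seteqP; split => // t [[_ nM2] /=]; rewrite in_itv/= => /andP[h1 h2].
    by apply: nM2; rewrite /= in_itv/=; apply/andP; split; lra.
  apply: lt_le_trans (phi1 _); apply: lt_le_trans (ler_norm _).
  have := tail _ mE; have := tail _ mG; rewrite !ler_norml => /andP[? ?] /andP[? ?].
  move: phiG; rewrite !linearB/= (split_int _ mG) (split_int _ mE) EG; lra.
have [f Hf] : exists f : nat -> set RT * R, ok (f 0%N) /\ forall i, ok (f i) ->
   [/\ ok (f i.+1), (f i).2 + 1 <= (f i.+1).2, (f i.+1).1 `&` `[- (f i).2, (f i).2] = (f i).1 &
    forall E : set RT, measurable E -> E `&` `[- (f i.+1).2, (f i.+1).2] = (f i.+1).1 -> e / 2 < `|pettis_int E - d i|].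
  have st (ip : nat * (set RT * R)) : exists p', ok ip.2 -> 
     [/\ ok p', ip.2.2 + 1 <= p'.2,
    p'.1 `&` `[- ip.2.2, ip.2.2] = ip.2.1 &
    forall E : set RT, measurable E -> E `&` `[- p'.2, p'.2] = p'.1 -> e / 2 < `|pettis_int E - d ip.1|].
    have [okp|nokp] := pselect (ok ip.2); last by exists (set0, 0).
    by have [p' hp'] := step ip.1 _ okp; exists p'.
  have [nxt Hnxt] := choice st.
  exists (fix g n := if n is n'.+1 then nxt (n', g n') else (set0, 1)); split.
    by split => //=.
  by move=> i; exact: (Hnxt (i, _)).
have [f0 fS] := Hf.
have okf i : ok (f i) by elim: i => // i /fS[].
pose E := \bigcup_i (f i).1.
have mE : measurable E by apply: bigcupT_measurable => i; have [] := okf i.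
have fmono i k : (f i).2 <= (f (i + k)%N).2.
  elim: k => [|k IH]; first by rewrite addn0.
  by rewrite addnS; have [_ h _ _] := fS _ (okf (i + k)%N); lra.
have fI i k : (f (i + k)%N).1 `&` `[- (f i).2, (f i).2] = (f i).1.
  elim: k => [|k IH].
    by rewrite addn0; apply/setIidPl; have [] := okf i.
  rewrite addnS -[RHS]IH; have [_ _ <- _] := fS _ (okf (i + k)%N).
  rewrite -setIA; congr (_ `&` _); apply/esym/setIidPr => t /=; rewrite !in_itv/=.
  by have h := fmono i k; move=> /andP[? ?]; apply/andP; split; lra.
have EI i : E `&` `[- (f i).2, (f i).2] = (f i).1.
  apply/seteqP; split => t.
    move=> [[j _ ft] ti]; have [ij|ji] := leqP i j.
      by rewrite -(fI i (j - i)%N) subnKC.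
    by move: ft; rewrite -(fI j (i - j)%N) subnKC ?(ltnW ji)// => -[].
  by move=> ft; split; [exists i|have [_ h _] := okf i; exact: h].
have [i hi] := Dd (pettis_int E).
have [_ _ _ /(_ E mE (EI _))] := fS _ (okf i).
by rewrite ltNge hi.
Qed.

End pettis_integral.
End line_pettis.

(** * Almost sure properties of the noise and lower bounds for its events *)

Section noise_events.
Context (R : realType) (lam : nat -> {nonneg R}).
Variable Q : probability noise R.
Hypothesis QE : forall S, Q (void S) =
  (void_prob (mark_measure lam) (\bigcup_(i in [set` S]) @cell R i))%:E.

Lemma measurable_bit i b : measurable [set w : noise | w i = b].
Proof.
have m0 : measurable [set w : noise | w i = false].
  rewrite (_ : [set _ | _] = void [:: i]); first exact: measurable_void.
  by apply/seteqP; split => w /= => [wi j|]; [rewrite inE => /eqP ->|apply; rewrite inE].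
case: b => //; rewrite (_ : [set _ | _] = ~` [set w : noise | w i = false]).
  exact: measurableC.
by apply/seteqP; split => w /=; case: (w i).
Qed.

(** The only trace of an underlying set of points that the bits are asked to keep. *)
Definition monotone_noise : set noise :=
  [set w | forall n (a b a' b' : rat), a' <= a -> b <= b' ->
     w (n, (a, b)) -> w (n, (a', b'))].

Lemma void_cons i S : void (i :: S) = [set w | w i = false] `&` void S.
Proof.
apply/seteqP; split => w /=.
  move=> vS; split; first by apply: vS; rewrite inE eqxx.
  by move=> j jS; apply: vS; rewrite inE jS orbT.
by move=> [wi vS] j; rewrite inE => /predU1P[->|/vS].
Qed.

(** Asking the smaller cell to be void in addition to the larger one does not change the union of
    the cells, hence not the void probability. *)
Lemma hit_subcell_null i j : @cell R i `<=` @cell R j ->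
  Q [set w | w i = true /\ w j = false] = 0%E.
Proof.
move=> ij.
have mv := measurable_void.
have -> : [set w : noise | w i = true /\ w j = false] = void [:: j] `\` void [:: i; j].
  rewrite !void_cons; apply/seteqP; split => w /=.
    by move=> [wi wj]; split; [split|move=> []; rewrite wi].
  by move=> [[wj _]]; case: (w i) => // h; exfalso; apply: h; split => //; split.
rewrite measureD//; last by rewrite ltey_eq fin_num_measure.
have /setIidPr -> : void [:: i; j] `<=` void [:: j].
  by rewrite !void_cons => w /= [_].
rewrite /= !QE -EFinB; congr EFin; apply/eqP; rewrite subr_eq0; apply/eqP.
congr (void_prob (mark_measure lam) _).
apply/seteqP; split => y [k /= kS cy].
  by exists k => //=; rewrite inE kS orbT.
move: kS; rewrite !inE => /orP[/eqP ki|kj]; last by exists k => //=; rewrite inE.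
by exists j; rewrite /= ?inE//; apply: ij; rewrite -ki.
Qed.

Lemma monotone_noise_negligible : Q.-negligible (~` monotone_noise).
Proof.
pose N (p : cell_index * cell_index) : set noise :=
  if `[< @cell R p.1 `<=` @cell R p.2 >] then [set w | w p.1 = true /\ w p.2 = false] else set0.
apply: (@negligibleS _ _ _ Q (\bigcup_k (if unpickle k is Some p then N p else set0))).
  move=> w /= /existsNP[n /existsNP[a /existsNP[b /existsNP[a' /existsNP[b' /not_implyP[aa' /not_implyP[bb' /not_implyP[wi wj]]]]]]]].
  exists (pickle ((n, (a, b)), (n, (a', b')))) => //; rewrite pickleK /N /=.
  rewrite asboolT.
    by split => //; apply/negbTE/negP.
  move=> [k x] [/= -> xab]; split => //=; move: xab; rewrite !in_itv/=.
  by rewrite -(ler_rat R) in aa'; rewrite -(ler_rat R) in bb'; move=> /andP[? ?]; apply/andP; split; lra.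
apply: negligible_bigcup => k; case: unpickle => [p|]; last exact: negligible_set0.
rewrite /N; case: asboolP => [pp|_]; last exact: negligible_set0.
exists [set w | w p.1 = true /\ w p.2 = false]; split => //; last exact: hit_subcell_null.
by apply: measurableI; exact: measurable_bit.
Qed.

Lemma measurable_monotone_noise : measurable monotone_noise.
Proof.
pose I5 : countType := (nat * ((rat * rat) * (rat * rat)))%type.
rewrite (_ : monotone_noise = ~` \bigcup_(p : I5)
   (if (p.2.2.1 <= p.2.1.1) && (p.2.1.2 <= p.2.2.2) then
      [set w | w (p.1, p.2.1) = true] `&` [set w | w (p.1, p.2.2) = false] else set0)).
  apply: measurableC; apply: countable_bigcupT_measurable => // p.
  by case: ifPn => _ //; apply: measurableI; exact: measurable_bit.
apply/seteqP; split => w.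
  move=> mw [[n [[a b] [a' b']]] _ /=]; case: ifPn => // /andP[h1 h2] /= [wi wj].
  by have := mw n a b a' b' h1 h2 wi; rewrite wj.
move=> nw n a b a' b' aa bb wi; apply/negPn/negP => /negbTE wj; apply: nw.
by exists (n, ((a, b), (a', b'))) => //=; rewrite aa bb.
Qed.

Definition cell_mass (i : cell_index) : R :=
  (lam i.1)%:num * Num.max 0 (ratr i.2.2 - ratr i.2.1).

Lemma void_prob_ge S : expR (- \sum_(i <- S) cell_mass i) <= fine (Q (void S)).
Proof.
rewrite QE /= /void_prob ler_expR lerN2.
suff : (mark_measure lam (\bigcup_(i in [set` S]) @cell R i) <= (\sum_(i <- S) cell_mass i)%:E)%E.
  move=> h; rewrite -lee_fin fineK// ge0_fin_numE//.
  exact: mark_measure_cells_lty.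
elim: S => [|i S IH].
  by rewrite big_nil (_ : \bigcup_(_ in _) _ = set0) ?measure0// bigcup0.
have -> : [set` i :: S] = i |` [set` S].
  by apply/seteqP; split => j /=; rewrite inE => /predU1P.
rewrite bigcup_setU1 big_cons EFinD.
apply: (@le_trans _ _ (mark_measure lam (@cell R i) +
   mark_measure lam (\bigcup_(i in [set` S]) @cell R i))%E).
  by apply: measureU2; [exact: measurable_cell|exact: measurable_cells_bigcup].
by rewrite mark_measure_cell leeD2l.
Qed.

(* The finite-volume bounds do not depend on the number of void cells, hence
   pass to the limit. *)
Lemma hit_void_ge (i : cell_index) (c : nat -> cell_index) (C : R) :
  (forall k, @cell R i `&` @cell R (c k) = set0) ->
  (forall K, \sum_(k < K) cell_mass (c k) <= C) ->
  expR (- C) * (1 - expR (- cell_mass i)) <=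
  fine (Q [set w | w i = true /\ forall k, w (c k) = false]).
Proof.
move=> ic cC.
pose D K : set noise := [set w | w i = true] `&` void [seq c k | k <- iota 0 K].
have mD K : measurable (D K).
  by apply: measurableI; [exact: measurable_bit|exact: measurable_void].
have -> : [set w : noise | w i = true /\ forall k, w (c k) = false] = \bigcap_K D K.
  apply/seteqP; split => w /=.
    by move=> [wi wc] K _; split => //= _ /mapP[k _ ->].
  move=> wD; split; first by have [] := wD 0%N I.
  move=> k; have [_ h] := wD k.+1 I; apply: h; apply: (map_f c).
  by rewrite mem_iota/= add0n.
have cvD : fine (Q (D K)) @[K --> \oo] --> fine (Q (\bigcap_K D K)).
  apply: fine_cvg; rewrite fineK ?fin_num_measure//; last exact: bigcapT_measurable.
  apply: (@nonincreasing_cvg_mu _ _ _ Q D) => //.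
  - by rewrite ltey_eq fin_num_measure.
  - exact: bigcapT_measurable.
  - apply/nonincreasing_seqP => K; apply/subsetPset => w [wi vS]; split => // j.
    by move=> /mapP[k]; rewrite mem_iota/= add0n => kK ->; apply: vS; apply: (map_f c); rewrite mem_iota/= add0n ltnS ltnW.
apply: cvgr_to_ge cvD _; apply: nearW => K.
set S := [seq c k | k <- iota 0 K].
(* Written as a difference of void events, the probability factors by independence, the cell [i]
   being disjoint from the others. *)
have -> : D K = void S `\` void (i :: S).
  rewrite void_cons; apply/seteqP; split => w /=.
    by move=> [wi vS]; split => // -[]; rewrite wi.
  by move=> [vS h]; split => //; case wi : (w i) => //; exfalso; apply: h; split.
rewrite measureD; try exact: measurable_void; last by rewrite ltey_eq fin_num_measure//; exact: measurable_void.
have /setIidPr -> : void (i :: S) `<=` void S by rewrite void_cons => w [].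
have mv := measurable_void.
rewrite fineB ?fin_num_measure//.
have -> : void (i :: S) = void [:: i] `&` void S.
  rewrite !void_cons; congr (_ `&` _); apply/esym/setIidPl => w _ j.
  by rewrite in_nil.
rewrite /= (void_independent QE); last first.
  rewrite (_ : [set` [:: i]] = [set i]); last first.
    by apply/seteqP; split => j /=; rewrite inE => /eqP.
  rewrite bigcup_set1; apply/seteqP; split => // y [iy [j /= /mapP[k _ ->] ky]].
  have : (@cell R i `&` @cell R (c k)) y by [].
  by rewrite ic.
rewrite fineM ?fin_num_measure// (_ : _ - _ * _ = fine (Q (void S)) * (1 - fine (Q (void [:: i])))); last by ring.
have Qi : fine (Q (void [:: i])) = expR (- cell_mass i).
  rewrite QE/= /void_prob; congr (expR (- _)).
  rewrite (_ : [set` [:: i]] = [set i]); last first.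
    by apply/seteqP; split => j /=; rewrite inE => /eqP.
  by rewrite bigcup_set1 /= mark_measure_cell.
rewrite Qi; apply: ler_pM; rewrite ?expR_ge0//.
  by rewrite subr_ge0 -[leRHS]expR0 ler_expR lerNl oppr0 mulr_ge0// le_max lexx.
apply: le_trans (void_prob_ge S); rewrite ler_expR lerN2 big_map.
by rewrite -[X in iota _ X]subn0 -/(index_iota 0 K) big_mkord.
Qed.

Lemma void_ge (c : nat -> cell_index) (C : R) :
  (forall K, \sum_(k < K) cell_mass (c k) <= C) ->
  expR (- C) <= fine (Q [set w | forall k, w (c k) = false]).
Proof.
move=> cC.
pose D K : set noise := void [seq c k | k <- iota 0 K].
have mD K : measurable (D K) by exact: measurable_void.
have -> : [set w : noise | forall k, w (c k) = false] = \bigcap_K D K.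
  apply/seteqP; split => w /=.
    by move=> wc K _ _ /mapP[k _ ->].
  move=> wD k; have h := wD k.+1 I; apply: h; apply: (map_f c).
  by rewrite mem_iota/= add0n.
have cvD : fine (Q (D K)) @[K --> \oo] --> fine (Q (\bigcap_K D K)).
  apply: fine_cvg; rewrite fineK ?fin_num_measure//; last exact: bigcapT_measurable.
  apply: (@nonincreasing_cvg_mu _ _ _ Q D) => //.
  - by rewrite ltey_eq fin_num_measure.
  - exact: bigcapT_measurable.
  - apply/nonincreasing_seqP => K; apply/subsetPset => w vS j.
    by move=> /mapP[k]; rewrite mem_iota/= add0n => kK ->; apply: vS; apply: (map_f c); rewrite mem_iota/= add0n ltnS ltnW.
apply: cvgr_to_ge cvD _; apply: nearW => K.
apply: le_trans (void_prob_ge _); rewrite ler_expR lerN2 big_map.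
by rewrite -[X in iota _ X]subn0 -/(index_iota 0 K) big_mkord.
Qed.
End noise_events.

(** * The random vector *)

Section measurability.
Context (R : realType) d (W : measurableType d).
Local Notation leb := (@lebesgue_measure R).
Local Notation RT := (measurableTypeR R).

(** Fubini-Tonelli for the positive and the negative part of [f], each restricted to [A]. *)
Lemma measurable_Rintegral_section (f : RT -> R) (A : set (W * RT)) :
  measurable_fun setT f -> measurable A ->
  measurable_fun setT (fun w => \int[leb]_(t in [set t | A (w, t)]) f t).
Proof.
move=> mf mA; have mEf : measurable_fun setT (EFin \o f) by exact/measurable_EFinP.
have key (g : RT -> \bar R) : measurable_fun setT g -> (forall t, 0 <= g t)%E ->
    measurable_fun setT (fun w => \int[leb]_(t in [set t | A (w, t)]) g t)%E.
  move=> mg g0.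
  rewrite (_ : (fun w => _) = fubini_F leb ((g \o snd) \_ A)).
    apply: measurable_fun_fubini_tonelli_F; last first.
      by move=> p; rewrite patchE; case: ifP => // _; exact: g0.
    apply/(measurable_restrictT _ mA); apply: measurable_funTS.
    exact: (measurableT_comp mg).
  apply/funext => w; rewrite /fubini_F [LHS]integral_mkcond.
  apply: eq_integral => t _; rewrite !patchE /=; congr (if _ then _ else _).
rewrite /Rintegral; apply: measurableT_comp => //.
rewrite (_ : (fun w => _) = (fun w => \int[leb]_(t in [set t | A (w, t)]) ((EFin \o f)^\+ t) -
   \int[leb]_(t in [set t | A (w, t)]) ((EFin \o f)^\- t))%E); last first.
  by apply/funext => w; rewrite integralE.
by apply: emeasurable_funB; apply: key => //; [exact: measurable_funepos|exact: measurable_funeneg].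
Qed.

Context (X : normedModType R).

(** Functionals norming a dense sequence are enough: all are 1-Lipschitz, so passing from [x] to a
    neighbour [ds i] costs twice their distance, whence [e / 2]. *)
Lemma norming_sequence : separable X -> exists psi : nat -> {linear X -> R^o},
  (forall i x, `|psi i x| <= `|x|) /\
  (forall x K, (forall i, psi i x <= K) -> `|x| <= K).
Proof.
move=> /separable_seq[ds dsX].
have [psi Hpsi] := choice (fun i => norming_functional (ds i)).
exists psi; split => [i x|x K hK]; first exact: (Hpsi i).1.
apply/ler_addgt0Pr => e e0.
have [i hi] := dsX x (e / 2) (divr_gt0 e0 (ltr0Sn _ _)).
have h1 : `|x| <= `|ds i| + `|x - ds i| by rewrite [leRHS]addrC -{1}[x](subrK (ds i)) ler_normD.
have h2 : psi i (ds i) <= psi i x + `|x - ds i|.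
  rewrite -lerBlDl -linearB; apply: le_trans (ler_norm _) _.
  by rewrite distrC; exact: (Hpsi i).1.
rewrite (Hpsi i).2 in h2; have := hK i; lra.
Qed.

(** Pettis measurability: by the norming sequence a closed ball is a countable intersection of
    half-spaces, and by separability an open set is a countable union of closed balls with centres
    in a fixed sequence and radii 1/(k + 1). *)
Lemma measurable_weak (G : W -> X) : separable X ->
  (forall phi : {linear X -> R^o}, (forall x, `|phi x| <= `|x|) ->
     measurable_fun setT (phi \o G)) ->
  measurable_fun setT (G : W -> borel X).
Proof.
move=> sepX mG.
have [psi [psi1 psiN]] := norming_sequence sepX.
have [ds dsX] := separable_seq sepX.
have mball c (r : R) : measurable [set w | `|G w - c| <= r].
  rewrite (_ : [set w | _] = \bigcap_i ((psi i \o G) @^-1` [set` `]-oo, r + psi i c]])).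
    apply: bigcapT_measurable => i; rewrite -[X in measurable X]setTI.
    by apply: mG (psi1 i) _ _ _ => //; exact: measurable_itv.
  apply/seteqP; split => w /=.
    move=> h i _ /=; rewrite in_itv/= -lerBlDr -linearB.
    exact: le_trans (ler_norm _) (le_trans (psi1 i _) h).
  move=> h; apply: psiN => i; have := h i I; rewrite /= in_itv/=.
  by rewrite linearB lerBlDr.
apply: (@measurability _ _ W (borel X) setT G (@open X)) => // _ [U oU <-].
rewrite setTI.
pose V (p : nat * nat) : set W :=
  if `[< [set y | `|ds p.1 - y| <= p.2.+1%:R^-1] `<=` U >] then
  [set w | `|G w - ds p.1| <= p.2.+1%:R^-1] else set0.
rewrite (_ : G @^-1` U = \bigcup_p V p).
  by apply: countable_bigcupT_measurable => // p; rewrite /V; case: asboolP.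
apply/seteqP; split => w /=.
  move=> Uw.
  have /nbhs_ballP[e /= e0 eU] : nbhs (G w) U by exact: open_nbhs_nbhs.
  have [k hk] : exists k : nat, k.+1%:R^-1 < e / 2.
    exists (Num.truncn (2 / e)).
    by rewrite invf_plt ?posrE ?divr_gt0// invf_div truncnS_gt.
  have k0 : 0 < k.+1%:R^-1 :> R by rewrite invr_gt0 ltr0n.
  have [i hi] := dsX (G w) _ k0.
  exists (i, k) => //; rewrite /V asboolT ?ltW//=; first exact: ltW.
  move=> y hy; have {}hy : `|ds i - y| <= k.+1%:R^-1 := hy.
  apply: eU; rewrite -ball_normE/=.
  rewrite -(subrKA (ds i)); apply: le_lt_trans (ler_normD _ _) _.
  move: hy hi hk; set r := _^-1 => hy hi hk; lra.
move=> [[i k] _]; rewrite /V /=; case: asboolP => //= + h; apply.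
by rewrite /= distrC.
Qed.

End measurability.

Section random_element.
Context (R : realType) (X : completeNormedModType R).
Local Notation leb := (@lebesgue_measure R).
Local Notation RT := (measurableTypeR R).
Hypothesis sepX : separable X.
Variables (u : nat -> R -> X) (delta : nat -> R).
Hypothesis pu : forall n, line_pettis (u n).

(* The union of the intervals ]p, p + delta n[ over the points [p] of mark [n],
   up to a null set, written so as to depend on countably many bits. *)
Definition pulses n (w : noise) : set RT :=
  [set s | exists a b : rat, [/\ a < b, w (n, (a, b)) & ratr b < s < ratr a + delta n]].

Lemma measurable_pulses_graph n :
  measurable [set p : noise * RT | pulses n p.1 p.2].
Proof.
rewrite (_ : [set p | _] = \bigcup_(q : rat * rat)
   (if q.1 < q.2 then [set w : noise | w (n, (q.1, q.2)) = true] `*` `]ratr q.2 : R, ratr q.1 + delta n[%classic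
    else set0)).
  apply: countable_bigcupT_measurable => // q; case: ifPn => // _.
  by apply: measurableX; [exact: measurable_bit|exact: measurable_itv].
apply/seteqP; split => -[w s] /=.
  move=> [a [b [ab wab sab]]]; exists (a, b) => //=; rewrite ab; split => //=.
move=> [[a b] _ /=]; case: ifPn => // ab [/= wab]; rewrite in_itv/= => sab.
by exists a, b.
Qed.

Lemma measurable_pulses n w : measurable (pulses n w).
Proof.
have := @pair1_measurable _ _ noise RT w measurableT _ (measurable_pulses_graph n).
by rewrite setTI.
Qed.

Lemma pulses_shift n t w :
  pulses n (noise_shift t w) = [set s | pulses n w (s - ratr t)].
Proof.
apply/seteqP; split => s /=.
  move=> [a [b [ab wab /andP[bs sa]]]]; exists (a - t), (b - t); split => //.
    by rewrite ltrD2r.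
  by rewrite !rmorphB/=; apply/andP; split; lra.
move=> [a [b [ab wab /andP[bs sa]]]]; exists (a + t), (b + t); split => //.
- by rewrite ltrD2r.
- by rewrite /noise_shift/= !addrK.
- by rewrite !rmorphD/=; apply/andP; split; lra.
Qed.

Definition pulse_value n w : X := pettis_int (u n) (pulses n w).

Lemma measurable_pulse_value n (phi : {linear X -> R^o}) :
  continuous phi -> measurable_fun setT (phi \o pulse_value n).
Proof.
move=> cphi; rewrite (_ : phi \o _ = fun w => \int[leb]_(t in [set t | pulses n w t]) phi (u n t)).
  apply: (measurable_Rintegral_section _ (measurable_pulses_graph n)).
  by have /integrableP[/measurable_EFinP] := (pu n).1 _ cphi.
by apply/funext => w /=; rewrite pettis_intP//; exact: measurable_pulses.
Qed.

End random_element.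

Lemma probability_setI_full d (Y : measurableType d) (R : realType)
    (P : probability Y R) (A G : set Y) : measurable A -> measurable G ->
  P (~` G) = 0%E -> P (A `&` G) = P A.
Proof.
move=> mA mG PG; rewrite [RHS](measureDI P mA mG).
rewrite [X in (X + _)%E](_ : _ = 0%E) ?add0e//.
apply/eqP; rewrite eq_le measure_ge0 andbT -PG le_measure ?inE//.
- exact: measurableD.
- exact: measurableC.
Qed.

Lemma probability_eq_on d (Y : measurableType d) (R : realType)
    (P : probability Y R) (A B G : set Y) : measurable A -> measurable B ->
  measurable G -> P (~` G) = 0%E -> A `&` G = B `&` G -> P A = P B.
Proof.
move=> mA mB mG PG AB.
by rewrite -(probability_setI_full mA mG PG) AB probability_setI_full.
Qed.

(** * Change of variables and translation of integrals *)

Section change_of_variables.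
Context d d' (Y : measurableType d) (Z : measurableType d') (R : realType).
Variables (mu : {measure set Y -> \bar R}) (nu : {measure set Z -> \bar R}) (g : Y -> Z).
Hypothesis mg : measurable_fun setT g.
Hypothesis gE : forall C, measurable C -> mu (g @^-1` C) = nu C.

Lemma ge0_integral_image (h : Z -> \bar R) (B : set Z) : measurable B ->
  measurable_fun setT h -> (forall z, 0 <= h z)%E ->
  (\int[mu]_(y in g @^-1` B) h (g y) = \int[nu]_(z in B) h z)%E.
Proof.
move=> mB mh h0; rewrite -[LHS](@ge0_integral_pushforward _ _ _ _ R g mg mu B h)//.
  by apply: eq_measure_integral => C mC _; exact: gE.
exact: measurable_funTS.
Qed.

Lemma Rintegral_image (f : Z -> R) (B : set Z) : measurable B ->
  measurable_fun setT f ->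
  \int[mu]_(y in g @^-1` B) f (g y) = \int[nu]_(z in B) f z.
Proof.
move=> mB mf; have mEf : measurable_fun setT (EFin \o f) by exact/measurable_EFinP.
rewrite /Rintegral; congr fine; rewrite integralE [RHS]integralE.
congr (_ - _)%E.
  rewrite -(@ge0_integral_image ((EFin \o f)^\+)%E) //; first by apply: eq_integral => s _; rewrite !funeposE.
  exact: measurable_funepos.
rewrite -(@ge0_integral_image ((EFin \o f)^\-)%E) //; first by apply: eq_integral => s _; rewrite !funenegE.
exact: measurable_funeneg.
Qed.

Lemma integrable_image (f : Z -> R) (B : set Z) : measurable B ->
  measurable_fun setT f ->
  mu.-integrable (g @^-1` B) (EFin \o (f \o g)) -> nu.-integrable B (EFin \o f).
Proof.
move=> mB mf /integrableP[_ foo]; apply/integrableP; split.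
  by apply/measurable_EFinP; exact: measurable_funTS.
rewrite -(@ge0_integral_image (fun z => `|(EFin \o f) z|)%E)//.
by apply: measurableT_comp => //; exact/measurable_EFinP.
Qed.

End change_of_variables.

Lemma Rintegral_shift (R : realType) (f : measurableTypeR R -> R) (t : R)
    (A : set (measurableTypeR R)) : measurable A -> measurable_fun setT f ->
  \int[@lebesgue_measure R]_(s in A) f (s + t) =
  \int[@lebesgue_measure R]_(s in [set s | A (s - t)]) f s.
Proof.
move=> mA mf; pose g (x : measurableTypeR R) : measurableTypeR R := x + t.
have mg : measurable_fun setT g by exact: measurable_funD.
rewrite -[RHS](Rintegral_image mg (@lebesgue_measure_shift R t))//.
  suff -> : g @^-1` [set s | A (s - t)] = A by [].
  by apply/seteqP; split => x; rewrite /g/= addrK.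
have mh : measurable_fun setT (fun x : measurableTypeR R => x - t : measurableTypeR R).
  exact: measurable_funB.
by have := mh measurableT _ mA; rewrite setTI.
Qed.

Section psi.
Context (R : realType) (X : completeNormedModType R).
Local Notation leb := (@lebesgue_measure R).
Local Notation RT := (measurableTypeR R).
Hypothesis sepX : separable X.
Variables (u : nat -> R -> X) (delta : nat -> R).
Hypothesis pu : forall n, line_pettis (u n).
Hypothesis delta_gt0 : forall n, 0 < delta n.

(** A pulse that meets the window starts at a point less than [delta n] before it; this is the
    reason for the margin in [M + delta n <= ratr B]. *)
Lemma void_pulses n (w : noise) (M : R) (B : rat) : M + delta n <= ratr B ->
  monotone_noise w -> w (n, (- B, B)) = false ->
  pulses delta n w `&` `[- M, M] = set0.
Proof.
move=> MB mw wB; apply/seteqP; split => // s [[a [b [ab wab /andP[bs sa]]]]].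
rewrite /= in_itv/= => /andP[Ms sM].
have := delta_gt0 n => d0.
suff : w (n, (- B, B)) by rewrite wB.
apply: (mw n a b) wab.
  by rewrite -(ler_rat R) rmorphN/=; lra.
by rewrite -(ler_rat R); lra.
Qed.

Variables (lam : nat -> {nonneg R}) (M : nat -> R) (B : nat -> rat).
Hypothesis tailM : forall n (E : set RT), measurable E ->
  E `&` `[- M n, M n] = set0 -> `|pettis_int (u n) E| <= 2^-1 ^+ n.
Hypothesis MB : forall n, M n + delta n <= ratr (B n).
Hypothesis lamB : forall n, cell_mass lam (n, (- B n, B n)) <= 2^-1 ^+ n.
Variable Q : probability noise R.
Hypothesis QE : forall S, Q (void S) =
  (void_prob (mark_measure lam) (\bigcup_(i in [set` S]) @cell R i))%:E.

Local Notation pulse := (pulse_value u delta).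

(** From mark [N] on, no point falls where it could influence the window of its process; on monotone
    configurations the corresponding terms of the sum then obey the geometric bound. *)
Definition quiet N : set noise :=
  [set w | forall k, w ((N + k)%N, (- B (N + k)%N, B (N + k)%N)) = false].

Definition good_noise : set noise := monotone_noise `&` \bigcup_N quiet N.

Lemma measurable_quiet N : measurable (quiet N).
Proof.
rewrite (_ : quiet N = \bigcap_k [set w : noise | w ((N + k)%N, (- B (N + k)%N, B (N + k)%N)) = false]).
  by apply: bigcapT_measurable => k; exact: measurable_bit.
by apply/seteqP; split => w h k => [_|]; exact: h.
Qed.

Lemma measurable_good_noise : measurable good_noise.
Proof.
apply: measurableI; first exact: measurable_monotone_noise.
by apply: bigcupT_measurable => N; exact: measurable_quiet.
Qed.

Lemma sum_half_le K : \sum_(k < K) (2^-1 : R) ^+ k <= 2.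
Proof.
suff -> : \sum_(k < K) (2^-1 : R) ^+ k = 2 - 2 * 2^-1 ^+ K.
  by rewrite lerBlDr lerDl mulr_ge0// exprn_ge0// invr_ge0.
elim: K => [|K IH]; first by rewrite big_ord0 expr0; lra.
by rewrite big_ord_recr/= IH exprS; lra.
Qed.

(** A Borel-Cantelli estimate: the masses of the forbidden cells add up to at most [2 * 2^-1 ^+ N],
    and exp(- C) is at least 1 - C. *)
Lemma quiet_ge N : 1 - 2 * 2^-1 ^+ N <= fine (Q (quiet N)).
Proof.
have hC K : \sum_(k < K) cell_mass lam ((N + k)%N, (- B (N + k)%N, B (N + k)%N)) <=
    2 * 2^-1 ^+ N.
  apply: (@le_trans _ _ (\sum_(k < K) 2^-1 ^+ N * 2^-1 ^+ k)).
    by apply: ler_sum => k _; rewrite -exprD; exact: lamB.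
  rewrite -mulr_sumr mulrC ler_wpM2r//.
  exact: sum_half_le.
apply: le_trans (void_ge QE (c := fun k => ((N + k)%N, (- B (N + k)%N, B (N + k)%N))) hC).
exact: expR_ge1Dx.
Qed.

Lemma monotone_noise_full : Q (~` monotone_noise) = 0%E.
Proof.
apply: measure_negligible; first exact: measurableC measurable_monotone_noise.
exact: monotone_noise_negligible QE.
Qed.

Lemma good_noise_full : Q (~` good_noise) = 0%E.
Proof.
have mg := measurable_good_noise.
have mU : measurable (\bigcup_N quiet N) by apply: bigcupT_measurable => N; exact: measurable_quiet.
have Q1 : Q (\bigcup_N quiet N) = 1%E.
  apply/eqP; rewrite eq_le probability_le1//= -[leRHS]fineK ?fin_num_measure// lee_fin.
  apply/ler_addgt0Pr => e e0; rewrite -lerBlDr.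
  have [N hN] : exists N, 2 * (2^-1 : R) ^+ N <= e.
    have : (2^-1 : R) ^+ n @[n --> \oo] --> 0 by apply: cvg_expr; rewrite ger0_norm// invf_lt1// ltr1n.
    move=> /cvgrPdist_le /(_ (e / 2)) [|N _ /(_ N (leqnn N)) /=]; first by rewrite divr_gt0.
    by rewrite sub0r normrN ger0_norm ?exprn_ge0// => h; exists N; lra.
  apply: (@le_trans _ _ (1 - 2 * 2^-1 ^+ N)); first by rewrite lerB.
  apply: le_trans (quiet_ge N) _; rewrite fine_le ?fin_num_measure//; try exact: measurable_quiet.
  by rewrite le_measure ?inE//; [exact: measurable_quiet|exact: bigcup_sup].
apply/eqP; rewrite eq_le measure_ge0 andbT /good_noise setCI.
apply: le_trans (measureU2 _ _ _) _.
- exact: measurableC measurable_monotone_noise.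
- exact: measurableC.
- by rewrite /= monotone_noise_full probability_setC// Q1 subee// add0e.
Qed.

Definition psi_sum N (w : noise) : X := \sum_(n < N) pulse n w.

(** The value 0 off the good configurations keeps [psi] measurable: composed with a functional, it
    is a pointwise limit of finite sums times an indicator function. *)
Definition psi (w : noise) : X :=
  if `[< good_noise w >] then lim (psi_sum N w @[N --> \oo]) else 0.

Lemma pulse_small n w : monotone_noise w -> w (n, (- B n, B n)) = false ->
  `|pulse n w| <= 2^-1 ^+ n.
Proof.
move=> mw wB; apply: tailM; first exact: measurable_pulses.
exact: void_pulses (MB n) mw wB.
Qed.

Lemma psi_sum_cvg w : good_noise w -> psi_sum N w @[N --> \oo] --> psi w.
Proof.
move=> gw; rewrite /psi asboolT//; have [mw [N _ hN]] := gw.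
suff : cvgn (series (pulse ^~ w)).
  by rewrite /series /= (_ : (fun n => _) = psi_sum ^~ w)//; apply/funext => n; rewrite big_mkord.
(* The first [N] terms carry no bound; they are replaced by 0 before the comparison with the
   geometric series. *)
apply: normed_cvg; rewrite -(is_cvg_series_restrict N).
rewrite (_ : (fun n => _) = fun n => \sum_(N <= k < n) (fun k => if (N <= k)%N then `|pulse k w| else 0) k); last first.
  by apply/funext => n; apply: eq_big_nat => k /andP[-> _].
rewrite (is_cvg_series_restrict N).
apply: (@series_le_cvg R _ (geometric 1 2^-1)).
- by move=> n; case: ifP.
- by move=> n; rewrite /geometric /= mul1r exprn_ge0.
- move=> n; rewrite /geometric /= mul1r; case: ifP => [Nn|_]; last by rewrite exprn_ge0.
  by apply: pulse_small => //; have := hN (n - N)%N; rewrite subnKC.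
- by apply: is_cvg_geometric_series; rewrite ger0_norm// invf_lt1// ltr1n.
Qed.

Lemma measurable_psi : measurable_fun setT (psi : noise -> borel X).
Proof.
apply: measurable_weak => // phi phi1; have cphi := contractive_continuous phi1.
pose h N w := (\sum_(n < N) phi (pulse n w)) * \1_good_noise w.
apply: (@measurable_fun_cvg _ _ R setT h).
  move=> N; apply: measurable_funM; last exact: measurable_indic measurable_good_noise.
  elim: N => [|N IH].
    by rewrite (_ : (fun w => _) = cst 0)//; apply/funext => w; rewrite big_ord0.
  rewrite (_ : (fun w => _) = (fun w => \sum_(n < N) phi (pulse n w) + phi (pulse N w))).
    by apply: measurable_funD => //; exact: measurable_pulse_value.
  by apply/funext => w; rewrite big_ord_recr.
move=> w _ /=; have [gw|ngw] := pselect (good_noise w).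
  rewrite /h indicE mem_set//; under eq_cvg do rewrite mulr1 -raddf_sum.
  by apply: (cvg_comp _ _ (psi_sum_cvg gw)); exact: cphi.
rewrite /h indicE memNset//; under eq_cvg do rewrite mulr0.
by rewrite /psi asboolF// linear0; exact: cvg_cst.
Qed.

Section full_support.
Hypothesis lam_gt0 : forall n, 0 < (lam n)%:num.

Lemma sum_le_tail (f : nat -> R) N K : (forall k, 0 <= f k) ->
  (forall k, (N <= k)%N -> f k <= 2^-1 ^+ k) ->
  \sum_(k < K) f k <= \sum_(k < N) f k + 2 * 2^-1 ^+ N.
Proof.
move=> f0 fN; apply: (@le_trans _ _ (\sum_(k < N + K) f k)).
  by rewrite addnC big_split_ord/= lerDl sumr_ge0.
rewrite big_split_ord/= lerD2l.
apply: (@le_trans _ _ (\sum_(k < K) 2^-1 ^+ N * 2^-1 ^+ k)).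
  by apply: ler_sum => k _; rewrite -exprD; apply: fN; rewrite leq_addr.
by rewrite -mulr_sumr mulrC ler_wpM2r// sum_half_le.
Qed.

(** Whatever the position of the points in [0, eta[, their pulses cover ]eta, delta n[ and end
    before [delta n + eta]. The two void cells exclude all other points whose pulses could meet the
    window, and [delta n <= M'] keeps ]eta, delta n[ inside it. *)
Lemma single_pulse n (w : noise) (M' : R) (B' eta : rat) :
  M' + delta n <= ratr B' -> delta n <= M' -> monotone_noise w ->
  w (n, (0, eta)) = true -> w (n, (- B', 0)) = false -> w (n, (eta, B')) = false ->
  0 < eta ->
  `]ratr eta, delta n[ `<=` pulses delta n w `&` `[- M', M'] /\
  pulses delta n w `&` `[- M', M'] `<=` `]0, delta n + ratr eta[.
Proof.
move=> MB' dM mw w0 wl wr eta0; have d0 := delta_gt0 n.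
have eta0' : 0 < ratr eta :> R by rewrite ltr0q.
split=> s /=; rewrite !in_itv/=.
  move=> /andP[h1 h2]; split; last by apply/andP; split; lra.
  by exists 0, eta; split => //; rewrite rmorph0 add0r h1 h2.
move=> [[a [b [ab wab /andP[bs sa]]]] /andP[Ms sM]].
have b0 : 0 < b.
  rewrite ltNge; apply/negP => b0; suff : w (n, (- B', 0)) by rewrite wl.
  by apply: (mw n a b) wab => //; rewrite -(ler_rat R) rmorphN/=; lra.
have aeta : a < eta.
  rewrite ltNge; apply/negP => aeta; suff : w (n, (eta, B')) by rewrite wr.
  by apply: (mw n a b) wab => //; rewrite -(ler_rat R); lra.
rewrite -(ltr_rat R) rmorph0 in b0; rewrite -(ltr_rat R) in aeta.
by apply/andP; split; lra.
Qed.

(** Origin of the factor 3: the measure of [E] is at most [2 * delta n], so replacing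
    [delta n *: u n] by [y] costs [2 * e]; that measure differs from [delta n] by at most [eta],
    which costs one more [e] since [eta * |y| <= e * delta n]. *)
Lemma single_pulse_value n (E : set RT) (y : X) (e eta : R) :
  measurable E -> 0 < eta -> eta <= delta n -> eta * `|y| <= e * delta n -> 0 <= e ->
  `]eta, delta n[ `<=` E -> E `<=` `]0, delta n + eta[ ->
  (forall s, 0 <= s <= 2 * delta n -> `|delta n *: u n s - y| <= e) ->
  `|pettis_int (u n) E - y| <= 3 * e.
Proof.
move=> mE eta0 etad etay e0 loE hiE uy; have d0 := delta_gt0 n.
have Eoo : (leb E < +oo)%E.
  apply: (@le_lt_trans _ _ (leb `]0, delta n + eta[%classic)).
    by rewrite le_measure ?inE//; exact: measurable_itv.
  by rewrite lebesgue_measure_itv/=; case: ifP => _; rewrite ltry.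
have leE : leb E = (fine (leb E))%:E by rewrite fineK// ge0_fin_numE.
have hi : fine (leb E) <= delta n + eta.
  rewrite -lee_fin -leE; apply: (@le_trans _ _ (leb `]0, delta n + eta[%classic)).
    by rewrite le_measure ?inE//; exact: measurable_itv.
  by rewrite lebesgue_measure_itv/= lte_fin addr_gt0// oppr0 adde0.
have lo : delta n - eta <= fine (leb E).
  rewrite -lee_fin -leE; apply: (@le_trans _ _ (leb `]eta, delta n[%classic)).
    rewrite lebesgue_measure_itv/= lte_fin; case: ltP => h; first by rewrite EFinB.
    by rewrite lee_fin; lra.
  by rewrite le_measure ?inE//; exact: measurable_itv.
apply: norm_le_functional => phi phi1; have cphi := contractive_continuous phi1.
have Ei : leb.-integrable E (EFin \o (phi \o u n)) by exact: pettis_integrable_on.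
have Ci : leb.-integrable E (EFin \o cst (phi y)).
  apply: measurable_bounded_integrable => //.
  by exists `|phi y|; split; rewrite ?num_real// => r hr x _ /=; exact: ltW.
have Di : leb.-integrable E (EFin \o (fun s => delta n * phi (u n s))).
  exact: (@integrableZl _ _ R leb E mE (delta n) _ Ei).
have err : `|delta n * phi (pettis_int (u n) E) - phi y * fine (leb E)| <= e * fine (leb E).
  rewrite pettis_intP// -RintegralZl// -Rintegral_cst// -RintegralB//.
  apply: normr_cst_Rintegral_le => //.
    exact: (@integrableB _ _ R leb E mE _ _ Di Ci).
  move=> s Es; rewrite /cst -linearZ -linearB; apply: le_trans (phi1 _) _; apply: uy.
  have /= := hiE _ Es; rewrite in_itv/= => /andP[? ?]; apply/andP; split; lra.
rewrite linearB -(ler_pM2l d0) mulrBr.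
have hphi := phi1 y.
have h1 : phi y * (fine (leb E) - delta n) <= `|y| * eta.
  apply: le_trans (ler_norm _) _; rewrite normrM ler_pM//.
  by rewrite ler_norml; apply/andP; split; lra.
have h2 : e * fine (leb E) <= e * (2 * delta n) by rewrite ler_wpM2l//; lra.
move: err; rewrite ler_norml => /andP[_ err]; nra.
Qed.

Lemma psi_full_support :
  (forall (x : X) (e : R), 0 < e -> exists n y, `|y - x| <= e /\
     forall s, 0 <= s <= 2 * delta n -> `|delta n *: u n s - y| <= e) ->
  forall U : set X, open U -> U !=set0 -> (0 < Q (psi @^-1` U))%E.
Proof.
move=> approx U oU [x Ux].
have /nbhs_ballP[r /= r0 rU] : nbhs x U by exact: open_nbhs_nbhs.
(* The budget: [4 * e] for pulse [n] ([3 * e] inside its window, [e] outside), [3 * e] for all other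
   pulses, [e] for the distance from [y] to [x]; the total [8 * e] is less than [r]. *)
pose e := r / 10; have e0 : 0 < e by rewrite divr_gt0.
have [n [y [yx uy]]] := approx x e e0.
have d0 := delta_gt0 n.
have [eta [eta0 etad etay]] : exists eta : rat, [/\ 0 < eta, ratr eta <= delta n &
    ratr eta * `|y| <= e * delta n].
  have y1 : 0 < `|y| + 1 by rewrite ltr_wpDl.
  have : 0 < Num.min (delta n) (e * delta n / (`|y| + 1)).
    by rewrite lt_min d0 divr_gt0// mulr_gt0.
  move=> /rat_in_itvoo[q]; rewrite in_itv/= lt_min => /andP[q0 /andP[q1 q2]].
  exists q; split; [by rewrite -(ltr_rat R) rmorph0|exact: ltW|].
  rewrite ltr_pdivlMr// in q2; apply: le_trans (ltW q2); rewrite ler_wpM2l//; lra.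
(* The given windows only guarantee [2^-1 ^+ k], too coarse for small [k]. The finitely many marks
   below [N] are watched on other windows, with error [e * 2^-1 ^+ k]. *)
have tail k : exists p : R * rat, [/\ delta k <= p.1, p.1 + delta k <= ratr p.2 &
   forall E : set RT, measurable E -> E `&` `[- p.1, p.1] = set0 -> `|pettis_int (u k) E| <= e * 2^-1 ^+ k].
  have [|M' [M'0 hM']] := pettis_int_tail (pu k) sepX (e := e * 2^-1 ^+ k).
    by rewrite mulr_gt0// exprn_gt0.
  pose M2 := Num.max M' (delta k).
  have M'M2 : M' <= M2 by rewrite le_max lexx.
  have [q hq] : exists q : rat, M2 + delta k <= ratr q.
    exists (Num.truncn (M2 + delta k)).+1%:R; rewrite ratr_nat; exact: ltW (truncnS_gt _).
  exists (M2, q); split => //=; first by rewrite le_max lexx orbT.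
  move=> E mE EM; apply: hM' => //; apply/seteqP; split => // s [Es /=].
  rewrite in_itv/= => /andP[h1 h2].
  suff : (E `&` `[- M2, M2]) s by rewrite EM.
  split => //=; rewrite in_itv/=.
  by apply/andP; split; lra.
have [p Hp] := choice tail.
have [N nN hN] : exists2 N, (n < N)%N & 2 * (2^-1 : R) ^+ N <= e.
  have : (2^-1 : R) ^+ n @[n --> \oo] --> 0 by apply: cvg_expr; rewrite ger0_norm// invf_lt1// ltr1n.
  move=> /cvgrPdist_le /(_ (e / 2)) [|N _ hN]; first by rewrite divr_gt0.
  exists (maxn N n.+1); first by rewrite leq_maxr.
  have /= := hN (maxn N n.+1) (leq_maxl _ _).
  by rewrite sub0r normrN ger0_norm ?exprn_ge0// => h; lra.
pose B' k := if (k < N)%N then (p k).2 else B k.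
(* The cells to be void: index 0 is the part of the window of mark [n] to the right of [0, eta[,
   index [n.+1] the part to its left, and every other index [k'.+1] the whole window of mark [k'].
   All are disjoint from the cell to be hit. *)
pose c k : cell_index := if k is k'.+1 then
  if k' == n then (n, (- B' n, 0)) else (k', (- B' k', B' k')) else (n, (eta, B' n)).
pose i : cell_index := (n, (0, eta)).
pose A : set noise := [set w | w i = true /\ forall k, w (c k) = false].
have mass_ge0 j : 0 <= cell_mass lam j by rewrite mulr_ge0// le_max lexx.
have QA : 0 < fine (Q A).
  pose C := cell_mass lam (c 0%N) + (\sum_(k < N) cell_mass lam (c k.+1) + 2 * 2^-1 ^+ N).
  apply: (@lt_le_trans _ _ (expR (- C) * (1 - expR (- cell_mass lam i)))).
    rewrite mulr_gt0 ?expR_gt0// subr_gt0 -[ltRHS]expR0 ltr_expR oppr_lt0.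
    rewrite mulr_gt0//= rmorph0 subr0 lt_max; apply/orP; right; by rewrite ltr0q.
  apply: (hit_void_ge QE).
    move=> [|k].
      apply/seteqP; split => // -[m s] [[/= _ h1] [/= _ h2]].
      by move: h1 h2; rewrite !in_itv/= => /andP[_ ?] /andP[? _]; lra.
    rewrite /c; case: eqVneq => [_|kn]; apply/seteqP; split => // -[m s] [[/= mn h1] [/= mn' h2]].
      by move: h1 h2; rewrite !in_itv/= rmorph0 => /andP[? _] /andP[_ ?]; lra.
    by move: kn; rewrite -mn' mn eqxx.
  case=> [|K]; first by rewrite big_ord0 addr_ge0// addr_ge0// ?sumr_ge0// mulr_ge0.
  rewrite big_ord_recl lerD2l.
  apply: (sum_le_tail (f := fun k => cell_mass lam (c k.+1))) => // k Nk.
  rewrite /c; case: eqVneq => [kn|_]; first by move: nN; rewrite -kn ltnNge Nk.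
  by rewrite /B' ltnNge Nk/=; exact: lamB.
have mA : measurable A.
  rewrite (_ : A = [set w : noise | w i = true] `&` \bigcap_k [set w : noise | w (c k) = false]).
    by apply: measurableI; [|apply: bigcapT_measurable => k]; exact: measurable_bit.
  by apply/seteqP; split => w [h1 h2]; split => // k; [move=> _|]; exact: h2.
have mpsi : measurable (psi @^-1` U).
  rewrite -[X in measurable X]setTI; apply: measurable_psi => //.
  exact: sub_sigma_algebra.
have mm := measurable_monotone_noise.
(* Monotone configurations have full measure, so requiring monotonicity keeps the event of positive
   probability; it is what lets void windows control pulses. *)
apply: (@lt_le_trans _ _ (Q (A `&` monotone_noise))).
  rewrite probability_setI_full//; last exact: monotone_noise_full.
  by rewrite -[ltRHS]fineK ?fin_num_measure// lte_fin.
rewrite le_measure ?inE//; first exact: measurableI.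
move=> w [[wi wc] mw].
have quietk k : k != n -> w (k, (- B' k, B' k)) = false.
  by move=> kn; have := wc k.+1; rewrite /c (negbTE kn).
have gw : good_noise w.
  split => //; exists N => // k.
  have := quietk (N + k)%N; rewrite /B' ltnNge leq_addr/=; apply.
  by rewrite gtn_eqF// (leq_trans nN)// leq_addr.
have [pn1 pn2 pn3] := Hp n.
have BN : B' n = (p n).2 by rewrite /B' nN.
have pulsen : `|pulse n w - y| <= 4 * e.
  have mP := measurable_pulses delta n w.
  have mI : measurable (`[- (p n).1, (p n).1]%classic : set RT) by exact: measurable_itv.
  have [lo hi] : `]ratr eta, delta n[ `<=` pulses delta n w `&` `[- (p n).1, (p n).1] /\
      pulses delta n w `&` `[- (p n).1, (p n).1] `<=` `]0, delta n + ratr eta[.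
    apply: (single_pulse pn2) => //.
    - by have := wc n.+1; rewrite /c eqxx BN.
    - by have := wc 0%N; rewrite /c BN.
  rewrite /pulse_value -(setUIDK (pulses delta n w) `[- (p n).1, (p n).1]%classic).
  rewrite (pettis_intU (pu n)); [|exact: measurableI|exact: measurableD|]; last first.
    by rewrite setDE setIACA setICr setI0.
  rewrite addrAC; apply: le_trans (ler_normD _ _) _.
  have h1 : `|pettis_int (u n) (pulses delta n w `&` `[- (p n).1, (p n).1]) - y| <= 3 * e.
    apply: (single_pulse_value (eta := ratr eta)) => //; rewrite ?ltr0q ?(ltW e0)//.
    exact: measurableI.
  have h2 : `|pettis_int (u n) (pulses delta n w `\` `[- (p n).1, (p n).1])| <= e.
    apply: le_trans (pn3 _ (measurableD mP mI) _) _.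
      by rewrite setDE -setIA setICl setI0.
    by rewrite ler_piMr ?(ltW e0)// exprn_ile1// invf_le1// ler1n.
  lra.
pose bnd k := if (k < N)%N then e * 2^-1 ^+ k else 2^-1 ^+ k.
have pulsek k : k != n -> `|pulse k w| <= bnd k.
  move=> kn; have := quietk k kn; rewrite /bnd /B'; case: ifPn => kN wk.
    have [_ h2 h3] := Hp k; apply: h3; first exact: measurable_pulses.
    exact: void_pulses h2 mw wk.
  exact: pulse_small.
have bnd0 k : 0 <= bnd k.
  by rewrite /bnd; case: ifP => _; rewrite ?mulr_ge0 ?exprn_ge0// ltW.
have sumb K : \sum_(k < K) bnd k <= 3 * e.
  apply: le_trans (sum_le_tail (N := N) K bnd0 _) _.
    by move=> k Nk; rewrite /bnd ltnNge Nk.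
  have : \sum_(k < N) bnd k <= e * 2.
    apply: (@le_trans _ _ (\sum_(k < N) e * 2^-1 ^+ k)).
      by apply: ler_sum => k _; rewrite /bnd ltn_ord.
    by rewrite -mulr_sumr ler_wpM2l// ?(ltW e0)// sum_half_le.
  lra.
have near_y : `|psi w - y| <= 7 * e.
  have cvn : `|psi_sum K w - y| @[K --> \oo] --> `|psi w - y|.
    by apply: cvg_norm; apply: cvgB; [exact: psi_sum_cvg|exact: cvg_cst].
  apply: cvgr_to_le cvn _; exists n.+1 => // K /= nK.
  rewrite /psi_sum (bigD1 (Ordinal nK))//= addrAC.
  apply: le_trans (ler_normD _ _) _.
  have -> : 7 * e = 4 * e + 3 * e by lra.
  apply: lerD => //; apply: le_trans (ler_norm_sum _ _ _) _.
  apply: le_trans (sumb K); rewrite [leRHS](bigD1 (Ordinal nK))//=.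
  apply: ler_wpDl => //; apply: ler_sum => k kn; apply: pulsek.
  by apply: contra kn => /eqP kn; apply/eqP/val_inj.
apply: rU; rewrite -ball_normE/= distrC.
rewrite -(subrKA y); apply: le_lt_trans (ler_normD _ _) _.
move: near_y yx; rewrite /e; lra.
Qed.

End full_support.

Section equivariance.
Variable T : R -> X -> X.
Hypothesis linT : forall t, 0 <= t -> linear (T t).
Hypothesis contT : forall t, 0 <= t -> continuous (T t).
Hypothesis orbit : forall n s t, 0 <= t -> T t (u n s) = u n (s + t).

(** Tested on functionals: the composite of [phi] with the operator is again a continuous
    functional, the orbit identity turns the operator into a translation of the integrand, and
    translation invariance of Lebesgue measure moves it to the random set. *)
Lemma pulse_equivariant n (t : rat) w : 0 <= t ->
  T (ratr t) (pulse n w) = pulse n (noise_shift t w).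
Proof.
move=> t0; have t0' : 0 <= ratr t :> R by rewrite ler0q.
pose Tt : {linear X -> X} := HB.pack (T (ratr t)) (GRing.isLinear.Build R X X _ _ (linT t0')).
apply: functional_separates => phi cphi.
have cphiT : continuous (phi \o Tt).
  by move=> x; apply: continuous_comp; [exact: (contT t0')|exact: cphi].
rewrite /pulse_value pettis_intP//; last exact: measurable_pulses.
rewrite -[LHS]/((phi \o Tt) _).
rewrite (@pettis_intP R X (u n) (pu n) (pulses delta n w) (phi \o Tt))//; last exact: measurable_pulses.
rewrite pulses_shift -Rintegral_shift.
- by apply: eq_Rintegral => s _ /=; rewrite orbit.
- exact: measurable_pulses.
- by have /integrableP[/measurable_EFinP] := (pu n).1 _ cphi.
Qed.

Lemma psi_equivariant (t : rat) w : 0 <= t -> good_noise w ->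
  good_noise (noise_shift t w) -> T (ratr t) (psi w) = psi (noise_shift t w).
Proof.
move=> t0 gw gtw; have t0' : 0 <= ratr t :> R by rewrite ler0q.
pose Tt : {linear X -> X} := HB.pack (T (ratr t)) (GRing.isLinear.Build R X X _ _ (linT t0')).
apply/esym; apply: (cvg_unique _ (psi_sum_cvg gtw)) => //.
rewrite (_ : (fun N => _) = fun N => Tt (psi_sum N w)).
  by apply: (cvg_comp _ _ (psi_sum_cvg gw)); exact: (contT t0').
apply/funext => N; rewrite /psi_sum raddf_sum; apply: eq_bigr => n _.
by rewrite -pulse_equivariant.
Qed.

Lemma psi_law : exists mu : probability (borel X) R,
  [/\ forall A, mu A = Q (psi @^-1` A),
    forall (A : set (borel X)) (t : rat), measurable A -> 0 <= t ->
      mu (T (ratr t) @^-1` A) = mu A &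
    forall A B : set (borel X), measurable A -> measurable B ->
      fine (mu (A `&` T (ratr t) @^-1` B)) @[t --> (+oo : set_system rat)] -->
      fine (mu A) * fine (mu B)].
Proof.
have [mu muE] := image_probability Q measurable_psi.
have mT t : 0 <= t -> measurable_fun setT (T t : borel X -> borel X).
  move=> t0; apply: (@measurability _ _ (borel X) (borel X) setT _ (@open X)) => //.
  move=> _ [U oU <-]; rewrite setTI; apply: sub_sigma_algebra.
  by move/continuousP : (contT t0); exact.
have mpre (A : set (borel X)) : measurable A -> measurable (psi @^-1` A).
  by move=> mA; rewrite -[X in measurable X]setTI; exact: measurable_psi.
have mTpre t (A : set (borel X)) : 0 <= t -> measurable A -> measurable (T t @^-1` A : set (borel X)).
  by move=> t0 mA; rewrite -[X in measurable X]setTI; exact: mT.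
have msh t (C : set noise) : measurable C -> measurable (noise_shift t @^-1` C).
  by move=> mC; rewrite -[X in measurable X]setTI; exact: measurable_noise_shift.
(* The intertwining relation is available when both the configuration and its shift are good; the
   second condition also has probability one, by invariance of [Q]. *)
pose G t := good_noise `&` noise_shift t @^-1` good_noise.
have mG t : measurable (G t).
  by apply: measurableI; [|apply: msh]; exact: measurable_good_noise.
have QG t : Q (~` G t) = 0%E.
  rewrite /G setCI; apply/eqP; rewrite eq_le measure_ge0 andbT.
  have mg := measurable_good_noise.
  apply: le_trans (measureU2 _ _ _) _; [exact: measurableC|by apply: measurableC; exact: msh|].
  rewrite /= preimage_setC (noise_shift_invariant QE)//; last exact: measurableC.
  by rewrite good_noise_full adde0.
have eqG t (A : set X) : 0 <= t -> psi @^-1` (T (ratr t) @^-1` A) `&` G t =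
    noise_shift t @^-1` (psi @^-1` A) `&` G t.
  by move=> t0; apply/seteqP; split => w /= [h [g1 g2]]; (split; [|by split]);
    move: h; rewrite /preimage/= psi_equivariant.
exists mu; split => //.
  move=> A t mA t0; have t0' : 0 <= ratr t :> R by rewrite ler0q.
  have mPA := mpre _ mA.
  transitivity (Q (noise_shift t @^-1` (psi @^-1` A))); last first.
    rewrite [LHS](noise_shift_invariant QE t mPA); exact: esym (muE A).
  transitivity (Q (psi @^-1` (T (ratr t) @^-1` A))); first exact: muE.
  apply: (@probability_eq_on _ noise R Q _ _ (G t)).
  - by apply: mpre; exact: mTpre.
  - exact: msh.
  - exact: mG.
  - exact: QG.
  - exact: eqG.
move=> A C mA mC.
have := noise_mixing QE (mpre _ mA) (mpre _ mC).
rewrite -!muE; apply: cvg_trans; apply: near_eq_cvg.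
exists 0; split; first exact: num_real.
move=> t t0; have t0' : 0 <= ratr t :> R by rewrite ler0q ltW.
rewrite muE preimage_setI; congr fine; apply/esym.
apply: (@probability_eq_on _ _ _ Q _ _ (G t)) => //.
- by apply: measurableI; [exact: mpre|apply: mpre; exact: mTpre].
- by apply: measurableI; [exact: mpre|apply: msh; exact: mpre].
- by rewrite -!setIA eqG// ltW.
Qed.

End equivariance.
End psi.

(** * From rational to real times *)

Section continuous_time.
Context (R : realType) (X : completeNormedModType R).
Variable T : R -> X -> X.
Hypothesis contT : forall t, 0 <= t -> continuous (T t).
Hypothesis TD : forall t s x, 0 <= t -> 0 <= s -> T (t + s) x = T t (T s x).
Hypothesis orbT : forall x, {within `[0, +oo[, continuous (fun t => T t x)}.
Variable mu : probability (borel X) R.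
Hypothesis mu_inv : forall (A : set (borel X)) (q : rat), measurable A -> 0 <= q ->
  mu (T (ratr q) @^-1` A) = mu A.

Lemma preimage_open t (U : set X) : 0 <= t -> open U -> open (T t @^-1` U).
Proof. by move=> t0 oU; move/continuousP : (contT t0); exact. Qed.

Lemma measurable_open_borel (U : set X) : open U -> measurable (U : set (borel X)).
Proof. exact: sub_sigma_algebra. Qed.

Lemma measurable_semigroup t : 0 <= t -> measurable_fun setT (T t : borel X -> borel X).
Proof.
move=> t0; apply: (@measurability _ _ (borel X) (borel X) setT _ (@open X)) => //.
move=> _ [U oU <-]; rewrite setTI; apply: measurable_open_borel.
exact: preimage_open.
Qed.

Lemma measurable_preimage_semigroup t (A : set (borel X)) : 0 <= t -> measurable A ->
  measurable (T t @^-1` A : set (borel X)).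
Proof. by move=> t0 mA; rewrite -[X in measurable X]setTI; exact: measurable_semigroup. Qed.

(* The orbit of a point of the open set [T t @^-1` U] stays in [U] for a short
   while after time [t]. *)
Lemma rational_time_approx t (U : set X) (e : R) : 0 <= t -> open U -> 0 < e ->
  exists q : rat, t < ratr q /\
    fine (mu (T t @^-1` U)) - fine (mu (T t @^-1` U `&` T (ratr q) @^-1` U)) <= e.
Proof.
move=> t0 oU e0.
have [q Hq] : exists q : nat -> rat, forall k, t < ratr (q k) < t + k.+1%:R^-1.
  suff /choice : forall k : nat, exists q : rat, t < ratr q < t + k.+1%:R^-1.
    by move=> [f Hf]; exists f.
  move=> k.
  have : t < t + k.+1%:R^-1 by rewrite ltrDl invr_gt0 ltr0n.
  by move=> /rat_in_itvoo[q]; rewrite in_itv/=; exists q.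
have q0 k : 0 <= ratr (q k) :> R by have /andP[h _] := Hq k; rewrite (le_trans t0)// ltW.
pose D : set (borel X) := T t @^-1` U.
(* Points of [D] whose orbit is in [U] at all times [q k] with [k] at least [K]. These sets increase
   to [D] because [q k] tends to [t] and orbits are continuous. *)
pose C K : set (borel X) := D `&` \bigcap_k (T (ratr (q (K + k)%N)) @^-1` U).
have mD : measurable D by apply: measurable_open_borel; exact: preimage_open.
have mC K : measurable (C K).
  apply: measurableI => //; apply: bigcapT_measurable => k; apply: measurable_open_borel.
  exact: preimage_open.
have DC : D = \bigcup_K C K.
  apply/seteqP; split => [x Dx|x [K _ []]//].
  have nU : nbhs (T t x) U by exact: open_nbhs_nbhs.
  have : (fun s => T s x) @ within [set s | 0 <= s] (nbhs t) --> T t x.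
    have tI : t \in (`[0, +oo[%classic : set R) by rewrite inE/= in_itv/= t0.
    have := @orbT x t; rewrite /continuous_at nbhs_subspace_in; last by move: tI; rewrite inE.
    by rewrite (_ : `[0, +oo[%classic = [set s : R | 0 <= s])//; apply/seteqP; split => s /=; rewrite in_itv/= andbT.
  move=> /(_ _ nU); rewrite /= /within/= => /nbhs_ballP[r /= r0 hr].
  have [K hK] : exists K : nat, K.+1%:R^-1 < r.
    exists (Num.truncn r^-1).
    by rewrite invf_plt ?posrE// truncnS_gt.
  exists K => //; split => // k _ /=; apply: hr; last exact: q0.
  have /andP[h1 h2] := Hq (K + k)%N; rewrite -ball_normE/= ltr_norml.
  have : (K + k).+1%:R^-1 <= K.+1%:R^-1 :> R by rewrite lef_pV2 ?posrE ?ltr0n// ler_nat ltnS leq_addr.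
  move: h2 hK; set a := _^-1; set b := _^-1 => h2 hK ab; apply/andP; split; lra.
have : fine (mu (C K)) @[K --> \oo] --> fine (mu D).
  apply: fine_cvg; rewrite fineK ?fin_num_measure// [X in mu X]DC.
  apply: (@nondecreasing_cvg_mu _ _ _ mu C) => //; first by rewrite -DC.
  apply/nondecreasing_seqP => K; apply/subsetPset => x [Dx h]; split => // k _.
  by have := h k.+1 I; rewrite addSnnS.
move=> /cvgrPdist_le /(_ _ e0) [K _ /(_ K (leqnn K)) /= hK].
exists (q K); split; first by have /andP[] := Hq K.
apply: le_trans hK; apply: le_trans (ler_norm _); rewrite lerD2l lerN2.
have mA : measurable (D `&` T (ratr (q K)) @^-1` U : set (borel X)).
  by apply: measurableI => //; apply: measurable_open_borel; exact: preimage_open.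
rewrite fine_le ?fin_num_measure// le_measure ?inE//.
by move=> x [Dx h]; split => //; have := h 0%N I; rewrite addn0.
Qed.

(** The approximation yields only that the measure of a preimage of an open set is at most that of
    the set. For the converse, pick a rational [q] above [t]: the open set has the measure of its
    preimage at time [q], which is the preimage at time [q - t] of the open set [T t @^-1] U, so the
    same inequality applies to the latter. *)
Lemma invariant_open t (U : set X) : 0 <= t -> open U ->
  mu (T t @^-1` U) = mu U.
Proof.
have le s (V : set X) : 0 <= s -> open V -> fine (mu (T s @^-1` V)) <= fine (mu V).
  move=> s0 oV; apply/ler_addgt0Pr => e e0.
  have [q [sq h]] := rational_time_approx s0 oV e0.
  have mV := measurable_open_borel oV.
  have q0 : 0 <= q by rewrite -(ler_rat R) rmorph0; lra.
  have q0' : 0 <= ratr q :> R by rewrite ler0q.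
  have : fine (mu (T s @^-1` V `&` T (ratr q) @^-1` V)) <= fine (mu V).
    rewrite -(mu_inv mV q0).
    have m1 := measurable_preimage_semigroup s0 mV.
    have m2 := measurable_preimage_semigroup q0' mV.
    have m3 := measurableI _ _ m1 m2.
    by rewrite fine_le ?fin_num_measure// le_measure ?inE//.
  lra.
move=> t0 oU.
have mU := measurable_open_borel oU.
have mtU := measurable_preimage_semigroup t0 mU.
have [q tq] : exists q : rat, t <= ratr q.
  by exists (Num.truncn t).+1%:R; rewrite ratr_nat; exact: ltW (truncnS_gt _).
have q0 : 0 <= q by rewrite -(ler_rat R) rmorph0; lra.
have tq0 : 0 <= ratr q - t by rewrite subr_ge0.
rewrite -[LHS]fineK ?fin_num_measure// -[RHS]fineK ?fin_num_measure//; congr EFin.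
apply/eqP; rewrite eq_le le//=.
rewrite -(mu_inv mU q0).
rewrite (_ : T (ratr q) @^-1` U = T (ratr q - t) @^-1` (T t @^-1` U)).
  by apply: le => //; exact: preimage_open.
apply/seteqP; split => x /=; rewrite -TD//; rewrite addrC subrK//.
Qed.

Lemma invariant_continuous_time : invariant_measure T mu.
Proof.
move=> A t mA t0.
have [nu nuE] := image_probability mu (measurable_semigroup t0).
rewrite -nuE; apply: (@probability_unique _ (borel X) _ _ _ (@open X)) => //.
  by move=> U V; exact: openI.
by move=> U oU; rewrite nuE; exact: invariant_open.
Qed.

Hypothesis mu_mix : forall A B : set (borel X), measurable A -> measurable B ->
  fine (mu (A `&` T (ratr q) @^-1` B)) @[q --> (+oo : set_system rat)] -->
  fine (mu A) * fine (mu B).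

(** For a rational [q] shortly after [t], [D] lies in [E] up to measure [e / 3]; by invariance they
    have equal measure, so [E] lies in [D] up to the same error. Replacing [t] by [q] thus costs at
    most [e / 3] whatever [A] is. The truncation [Num.max 0 t] gives a family indexed by all reals,
    the form that [cvg_subcontent] takes afterwards. *)
Lemma mixing_open (A : set (borel X)) (U : set X) : measurable A -> open U ->
  fine (mu (A `&` T (Num.max 0 t) @^-1` U)) @[t --> +oo] --> fine (mu A) * fine (mu U).
Proof.
move=> mA oU; have mU := measurable_open_borel oU.
apply/cvgrPdist_le => e e0; have e3 : 0 < e / 3 by rewrite divr_gt0.
have /cvgrPdist_le /(_ _ e3)[M [_ hM]] := mu_mix mA mU.
exists (Num.max 0 (ratr M)); split; first exact: num_real.
move=> t; rewrite gt_max => /andP[t0 Mt].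
rewrite (max_r (ltW t0)); have t0' := ltW t0.
have [q [tq h]] := rational_time_approx t0' oU e3.
have q0 : 0 <= q by rewrite -(ler_rat R) rmorph0; lra.
have q0' : 0 <= ratr q :> R by rewrite ler0q.
have Mq : M < q by rewrite -(ltr_rat R); lra.
have := hM _ Mq.
pose D : set (borel X) := T t @^-1` U; pose E : set (borel X) := T (ratr q) @^-1` U.
rewrite -/D -/E in h *.
have mD : measurable D := measurable_preimage_semigroup t0' mU.
have mE : measurable E := measurable_preimage_semigroup q0' mU.
have DE : fine (mu D) = fine (mu E).
  by rewrite /D /E invariant_continuous_time// invariant_continuous_time.
have fD (C F : set (borel X)) : measurable C -> measurable F ->
    fine (mu C) = fine (mu (C `\` F)) + fine (mu (C `&` F)).
  move=> mC mF; have mCF := measurableI _ _ mC mF; have mCD := measurableD mC mF.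
  by rewrite -fineD ?fin_num_measure// -measureDI.
have fle (C F : set (borel X)) : measurable C -> measurable F -> C `<=` F ->
    fine (mu C) <= fine (mu F).
  by move=> mC mF CF; rewrite fine_le ?fin_num_measure// le_measure ?inE.
have mAD := measurableI _ _ mA mD; have mAE := measurableI _ _ mA mE.
have a1 := fD _ _ mAD mE; have a2 := fD _ _ mAE mD.
have b1 := fD _ _ mD mE; have b2 := fD _ _ mE mD.
have mAED : measurable (A `&` E `\` D) by exact: measurableD.
have mADE : measurable (A `&` D `\` E) by exact: measurableD.
have c1 : fine (mu (A `&` D `\` E)) <= fine (mu (D `\` E)).
  by apply: fle => //; [exact: measurableD|move=> x [[]]].
have c2 : fine (mu (A `&` E `\` D)) <= fine (mu (E `\` D)).
  by apply: fle => //; [exact: measurableD|move=> x [[]]].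
have c3 : 0 <= fine (mu (A `&` D `\` E)) by rewrite fine_ge0.
have c4 : 0 <= fine (mu (A `&` E `\` D)) by rewrite fine_ge0.
rewrite (_ : A `&` E `&` D = A `&` D `&` E) in a2; last by rewrite setIAC.
rewrite [E `&` D]setIC in b2.
rewrite !ler_norml => /andP[? ?]; apply/andP; split; lra.
Qed.

Lemma mixing_continuous_time : strongly_mixing T mu.
Proof.
move=> A B mA mB.
have t0 (t : R) : 0 <= Num.max 0 t by rewrite le_max lexx.
have mI t (C : set (borel X)) : measurable C ->
    measurable (A `&` T (Num.max 0 t) @^-1` C : set (borel X)).
  by move=> mC; apply: measurableI => //; exact: measurable_preimage_semigroup.
have fU C D : measurable C -> measurable D -> C `&` D = set0 ->
    fine (mu (C `|` D)) = fine (mu C) + fine (mu D).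
  by move=> mC mD CD; rewrite measureU// fineD ?fin_num_measure.
have : fine (mu (A `&` T (Num.max 0 t) @^-1` B)) @[t --> +oo] --> fine (mu A) * fine (mu B).
  apply: (@cvg_subcontent _ (borel X) R mu R _ _
    (fun t D => fine (mu (A `&` T (Num.max 0 t) @^-1` D)))
    (fun D => fine (mu A) * fine (mu D)) (@open X)) => //.
  - by move=> U V; exact: openI.
  - move=> t; split => [D E mD mE DE|D mD].
      rewrite preimage_setU setIUr fU//; [exact: mI|exact: mI|].
      by rewrite setIACA setIid -preimage_setI DE preimage_set0 setI0.
    rewrite fine_ge0//= -(invariant_continuous_time mD (t0 t)).
    have mm : measurable (T (Num.max 0 t) @^-1` D : set (borel X)) by exact: measurable_preimage_semigroup.
    by rewrite fine_le ?fin_num_measure ?le_measure ?inE//; exact: mI.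
  - split => [D E mD mE DE|D mD]; first by rewrite fU// mulrDr.
    rewrite mulr_ge0 ?fine_ge0// ler_piMl ?fine_ge0//.
    by rewrite -lee_fin fineK ?fin_num_measure//; exact: probability_le1.
  - by apply: mixing_open => //; exact: openT.
  - by move=> U oU; exact: mixing_open.
move=> h; rewrite -(fineK (fin_num_measure mu _ mA)) -(fineK (fin_num_measure mu _ mB)) -EFinM.
have near_pos : \forall t \near (+oo : set_system R), 0 <= t.
  by exists 0; split; [exact: num_real|move=> t; exact: ltW].
apply/fine_cvgP; split.
  apply: filterS near_pos => t t0'; rewrite fin_num_measure//.
  by have := mI t _ mB; rewrite max_r.
apply: cvg_trans h; apply: near_eq_cvg.
by apply: filterS near_pos => t t0' /=; rewrite max_r.
Qed.

End continuous_time.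

(** * Orbits, complex scalars and conclusion *)

Section orbits.
Context (R : realType).
Local Notation leb := (@lebesgue_measure R).
Local Notation cleb := (@completed_lebesgue_measure R).
Local Notation RT := (measurableTypeR R).
Local Notation CT := (caratheodory_type (wlength (@idfun R))^*%mu).

Lemma measurable_completed (E : set RT) : measurable E -> lebesgue_measurable E.
Proof. by move=> mE; exact: sub_caratheodory. Qed.

Lemma measurable_completed_id : measurable_fun setT (fun t : CT => t : RT).
Proof. by move=> _ A mA; rewrite setTI; exact: measurable_completed. Qed.

Lemma measurable_completed_opp : measurable_fun setT (fun t : CT => - t : RT).
Proof.
move=> _ A mA; rewrite setTI; apply: measurable_completed.
have mo : measurable_fun setT (-%R : RT -> RT) by exact: oppr_measurable.
by have := mo measurableT _ mA; rewrite setTI.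
Qed.

Context (X : completeNormedModType R).
Variables (T S : R -> X -> X) (x : X).
Hypothesis orbT : forall y, {within `[0, +oo[, continuous (fun t => T t y)}.
Hypothesis T0 : forall y, T 0 y = y.
Hypothesis TD : forall t s y, 0 <= t -> 0 <= s -> T (t + s) y = T t (T s y).
Hypothesis TS : forall t, 0 < t -> T t (S t x) = x.
Hypothesis TSB : forall r t, 0 < t -> t < r -> T t (S r x) = S (r - t) x.
Hypothesis pettisT : @pettis_integrable R RealScalars X (fun t => T t x).
Hypothesis pettisS : @pettis_integrable R RealScalars X (fun t => S t x).

Definition two_sided_orbit s : X := if 0 <= s then T s x else S (- s) x.

Lemma two_sided_orbit_shift s t : 0 <= t ->
  T t (two_sided_orbit s) = two_sided_orbit (s + t).
Proof.
move=> t0; rewrite /two_sided_orbit; have [s0|s0] := leP 0 s.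
  by rewrite addr_ge0// -TD// addrC.
have ns0 : 0 < - s by rewrite oppr_gt0.
have [st|st|st] := ltgtP 0 (s + t).
- have -> : T t (S (- s) x) = T (s + t) (T (- s) (S (- s) x)).
    rewrite -TD; [|exact: ltW|exact: ltW].
    by rewrite addrAC subrr add0r.
  by rewrite TS.
- have [->|tn0] := eqVneq t 0; first by rewrite T0 addr0.
  rewrite TSB; [|by rewrite lt_def tn0|lra].
  by congr (S _ x); lra.
- rewrite -?st T0; have -> : t = - s by lra.
  exact: TS.
Qed.

(** No continuity of [S] is assumed. Near time [s] the orbit is the forward orbit, around time 1, of
    its own value at [s - 1]; as 1 is interior to [0, +oo[, strong continuity of the semigroup gives
    a two-sided limit. *)
Lemma two_sided_orbit_continuous : continuous two_sided_orbit.
Proof.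
move=> s; pose y := two_sided_orbit (s - 1).
have orbE : \forall r \near s, T (r - (s - 1)) y = two_sided_orbit r.
  near=> r; rewrite two_sided_orbit_shift; first by congr two_sided_orbit; lra.
  rewrite subr_ge0 ltW//; near: r; apply: lt_nbhsr; lra.
have cT1 : {for 1, continuous (fun t => T t y)}.
  have /continuous_within_itvcyP[h _] := @orbT y; apply: h.
  by rewrite in_itv/= ltr01.
apply: cvg_trans; first by apply: near_eq_cvg orbE.
rewrite -[two_sided_orbit s](_ : T (s - (s - 1)) y = _); last first.
  by rewrite two_sided_orbit_shift; [congr two_sided_orbit|]; lra.
apply: (@cvg_comp _ _ _ (fun r => r - (s - 1)) (fun t => T t y) _ (nbhs (s - (s - 1)))).
  by apply: cvgB; [exact: cvg_id|exact: cvg_cst].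
by rewrite (_ : s - (s - 1) = 1); [exact: cT1|lra].
Unshelve. all: by end_near. Qed.

(** By continuity the orbit is Borel after any functional, so integrals for the completed and the
    Borel measure agree. Both halves use one change of variables, along the identity for [T] and
    along the reflection for [S], each seen as a map from the completed line to the Borel line. *)
Lemma two_sided_orbit_pettis : line_pettis two_sided_orbit.
Proof.
set u := two_sided_orbit.
have mphi (phi : {linear X -> R^o}) : continuous phi -> measurable_fun setT (phi \o u : RT -> R).
  move=> cphi; apply: continuous_measurable_fun => s.
  by apply: continuous_comp; [exact: two_sided_orbit_continuous|exact: cphi].
have mpos : measurable (`[0, +oo[%classic : set RT) by exact: measurable_itv.
have mneg : measurable (`]-oo, 0[%classic : set RT) by exact: measurable_itv.
have gE (C : set RT) : measurable C -> cleb ((fun t : CT => - t : RT) @^-1` C) = leb C.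
  exact: lebesgue_measureN.
have iE (C : set RT) : measurable C -> cleb ((fun t : CT => t : RT) @^-1` C) = leb C.
  by [].
have nuE s : `]-oo, 0[%classic (- s) -> u (- s) = S s x.
  by rewrite /= in_itv/= oppr_lt0 => s0; rewrite /u /two_sided_orbit oppr_ge0 leNgt s0 opprK.
have puE s : `[0, +oo[%classic s -> u s = T s x.
  by rewrite /= in_itv/= andbT /u /two_sided_orbit => ->.
have posneg : (`[0, +oo[ `|` `]-oo, 0[ = setT :> set R)%classic.
  by apply/seteqP; split => // s _ /=; rewrite !in_itv/= andbT; case: leP; [left|right].
have disj : (`[0, +oo[ `&` `]-oo, 0[ = set0 :> set R)%classic.
  by apply/seteqP; split => // s /= []; rewrite !in_itv/= andbT => h; rewrite ltNge h.
have ipos (phi : {linear X -> R^o}) : continuous phi ->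
    leb.-integrable `[0, +oo[ (EFin \o (phi \o u)).
  move=> cphi; apply: (integrable_image measurable_completed_id iE mpos (mphi _ cphi)).
  have := pettisT.1 phi cphi; apply: eq_integrable; first exact: measurable_completed.
  by move=> s; rewrite inE => /puE /= ->.
have ineg (phi : {linear X -> R^o}) : continuous phi ->
    leb.-integrable `]-oo, 0[ (EFin \o (phi \o u)).
  move=> cphi; apply: (integrable_image measurable_completed_opp gE mneg (mphi _ cphi)).
  have mD := measurable_completed_opp measurableT mneg; rewrite setTI in mD.
  have := pettisS.1 phi cphi => /(integrableS (measurable_completed mpos) mD).
  move=> H; apply: eq_integrable (H _) => //.
    by move=> s; rewrite inE => /nuE /= ->.
  by move=> s /=; rewrite !in_itv/= andbT oppr_lt0 => /ltW.
have itot (phi : {linear X -> R^o}) : continuous phi ->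
    leb.-integrable setT (EFin \o (phi \o u)).
  move=> cphi.
  have := integrableD measurableT
     ((integrable_mkcond _ mpos).1 (ipos _ cphi)) ((integrable_mkcond _ mneg).1 (ineg _ cphi)).
  apply: eq_integrable => // s _; rewrite !patchE /=.
  have [s0|s0] := leP 0 s.
    by rewrite mem_set ?memNset ?adde0//= in_itv/= ?andbT//; apply/negP; rewrite -leNgt.
  by rewrite memNset ?mem_set ?add0e//= in_itv/= ?andbT//; apply/negP; rewrite -ltNge.
split=> [//|E mE].
have mEp : measurable (E `&` `[0, +oo[) by exact: measurableI.
have mEn : measurable (E `&` `]-oo, 0[) by exact: measurableI.
have [|xp Hp] := pettisT.2 _ (measurable_completed mEp); first exact: subIsetr.
have mDn := measurable_completed_opp measurableT mEn; rewrite setTI in mDn.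
have [|xn Hn] := pettisS.2 _ mDn.
  by move=> s [_ /=]; rewrite !in_itv/= andbT oppr_lt0 => /ltW.
exists (xp + xn) => phi cphi.
rewrite linearD (Hp phi cphi) (Hn phi cphi) /=.
rewrite [X in _ = Rintegral _ X _](_ : E = (E `&` `[0, +oo[) `|` (E `&` `]-oo, 0[)); last first.
  by rewrite -setIUr posneg setIT.
rewrite Rintegral_setU//.
- congr (_ + _).
    rewrite -[RHS](Rintegral_image measurable_completed_id iE mEp (mphi _ cphi)).
    by apply: eq_Rintegral => s; rewrite inE => -[_ /puE /= ->].
  rewrite -[RHS](Rintegral_image measurable_completed_opp gE mEn (mphi _ cphi)).
  by apply: eq_Rintegral => s; rewrite inE => -[_ /nuE /= ->].
- by apply: integrableS (itot _ cphi) => //; exact: measurableU.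
- by apply/disj_set2P; rewrite setIACA disj setI0.
Qed.

End orbits.

(** A copy of the space that receives the real structure. It keeps the uniform structure of [X], so
    open sets, density, separability and Borel sets are literally the same, and a measure found on
    the copy is one on [X]. *)
Definition realify (R : realType) (X : Type) : Type := X.

Section realify.
Variables (R : realType) (X : completeNormedModType R[i]).
Notation Y := (realify R X).

HB.instance Definition _ := Complete.on Y.
HB.instance Definition _ := GRing.Zmodule.on Y.

Definition rscale (a : R) (x : Y) : Y := (a%:C)%C *: (x : X).
Lemma rscaleA a b v : rscale a (rscale b v) = rscale (a * b) v.
Proof. by rewrite /rscale scalerA rmorphM. Qed.
Lemma rscale1 : left_id 1 rscale.
Proof. by move=> x; rewrite /rscale rmorph1 scale1r. Qed.
Lemma rscaleDr : right_distributive rscale +%R.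
Proof. by move=> a x y; rewrite /rscale scalerDr. Qed.
Lemma rscaleDl v : {morph rscale^~ v : a b / a + b}.
Proof. by move=> a b; rewrite /rscale rmorphD/= scalerDl. Qed.
HB.instance Definition _ := GRing.Zmodule_isLmodule.Build R Y
  rscaleA rscale1 rscaleDr rscaleDl.

(** The norm of a complex space is an element of [R[i]]; being nonnegative, it has no imaginary
    part, so nothing is lost. *)
Definition rnorm (x : Y) : R := complex.Re `|x : X|.
Lemma rnormE (x : X) : `|x| = ((rnorm x)%:C)%C.
Proof.
rewrite /rnorm; have := normr_ge0 x; case: (`|x|) => a b.
by rewrite lecE /= => /andP[/eqP -> _].
Qed.
Lemma ler_rnormD x y : rnorm (x + y) <= rnorm x + rnorm y.
Proof. by have := ler_normD (x : X) y; rewrite !rnormE -rmorphD/= lecR. Qed.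
Lemma rnormMn x n : rnorm (x *+ n) = rnorm x *+ n.
Proof. by have := normrMn (x : X) n; rewrite !rnormE -rmorphMn => -[]. Qed.
Lemma rnormN x : rnorm (- x) = rnorm x.
Proof. by rewrite /rnorm normrN. Qed.
Lemma rnorm0_eq0 x : rnorm x = 0 -> x = 0.
Proof. by move=> h; apply: (@normr0_eq0 _ X); rewrite rnormE h. Qed.
HB.instance Definition _ := Num.Zmodule_isNormed.Build R Y
   ler_rnormD rnorm0_eq0 rnormMn rnormN.

Definition rball (x : Y) (e : R) : set Y := ball (x : X) (e%:C)%C.
Lemma rball_center x (e : R) : 0 < e -> rball x e x.
Proof. by move=> e0; apply: ballxx; rewrite ltcR. Qed.
Lemma rball_sym x y (e : R) : rball x e y -> rball y e x.
Proof. exact: ball_sym. Qed.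
Lemma rball_triangle x y z (e1 e2 : R) : rball x e1 y -> rball y e2 z -> rball x (e1 + e2) z.
Proof. by move=> h1 h2; rewrite /rball rmorphD; exact: ball_triangle h1 h2. Qed.
Lemma rball_entourage : entourage = entourage_ rball.
Proof.
rewrite predeqE => E; split.
  rewrite -(@entourage_ballE _ X) => -[e e0 eE].
  have : (0 : R[i]) < e by [].
  rewrite ltcE/= => /andP[/eqP e1 e2].
  exists (complex.Re e) => //= -[x y] /= h; apply: eE => /=.
  by move: h; rewrite /rball; case: (e) e1 => a b /= ->.
move=> [e e0 eE]; rewrite -(@entourage_ballE _ X); exists (e%:C)%C => //=.
by rewrite ltcR.
Qed.
HB.instance Definition _ := Uniform_isPseudoMetric.Build R Y
  rball_center rball_sym rball_triangle rball_entourage.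
Lemma rball_norm : (ball : Y -> R -> set Y) = ball_ (fun x => `| x |).
Proof.
apply/funext => x; apply/funext => e; apply/seteqP; split => y.
  rewrite /ball/= /rball -(@ball_normE _ X) /ball_/= [X in X -> _]/=.
  by rewrite rnormE ltcR.
rewrite /ball/= /rball -(@ball_normE _ X) /ball_/=.
by rewrite rnormE ltcR.
Qed.
HB.instance Definition _ := NormedZmod_PseudoMetric_eq.Build R Y rball_norm.
Lemma rnormZ (l : R) (x : Y) : `| l *: x | = `| l | * `| x |.
Proof.
have := normrZ (l%:C)%C (x : X); rewrite !rnormE normc_def/= expr0n addr0 sqrtr_sqr.
by rewrite -rmorphM => -[].
Qed.
HB.instance Definition _ := PseudoMetricNormedZmod_Lmodule_isNormedModule.Build R Y rnormZ.
HB.instance Definition _ := Complete.on Y.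
End realify.

Lemma line_pettisZ (R : realType) (X : normedModType R) (c : R) (u : R -> X) :
  line_pettis u -> line_pettis (fun s => c *: u s).
Proof.
move=> [ui uE]; split=> [phi cphi|E mE].
  rewrite (_ : EFin \o _ = fun s => (c%:E * (EFin \o (phi \o u)) s)%E).
    by apply: integrableZl => //; exact: ui.
  by apply/funext => s /=; rewrite linearZ.
have [x Hx] := uE E mE; exists (c *: x) => phi cphi.
rewrite linearZ (Hx phi cphi) -[LHS]/(c * _) -RintegralZl//.
  by apply: eq_Rintegral => s _; rewrite linearZ.
by apply: integrableS (ui _ cphi).
Qed.

Section real_case.
Context (R : realType) (X : completeNormedModType R).

(** A countable dense set of [X] need not meet [X0]: each of its points is approximated from [X0]
    within 1/(k + 1) for every [k], and the resulting double family is enumerated. *)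
Lemma dense_sequence_in (X0 : set X) : separable X -> dense X0 ->
  exists x : nat -> X, (forall j, X0 (x j)) /\
    forall y (e : R), 0 < e -> exists j, `|x j - y| < e.
Proof.
move=> /separable_seq[d dX] dX0.
have pick (p : nat * nat) : exists x, X0 x /\ `|x - d p.1| < p.2.+1%:R^-1.
  have [||x [bx X0x]] := dX0 (ball (d p.1) (p.2.+1%:R^-1)).
  - by exists (d p.1); apply: ballxx; rewrite invr_gt0 ltr0n.
  - exact: ball_open.
  - by exists x; split => //; move: bx; rewrite -ball_normE/= distrC.
have [f Hf] := choice pick.
exists (fun j => f (odflt (0%N, 0%N) (unpickle j))); split => [j|y e e0]; first exact: (Hf _).1.
have [i hi] := dX y (e / 2) (divr_gt0 e0 (ltr0Sn _ _)).
have [k hk] : exists k : nat, k.+1%:R^-1 < e / 2.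
  exists (Num.truncn (2 / e)).
  by rewrite invf_plt ?posrE ?divr_gt0// invf_div truncnS_gt.
exists (pickle (i, k)); rewrite pickleK /=.
have := (Hf (i, k)).2; rewrite /= => h.
rewrite -(subrKA (d i)); apply: le_lt_trans (ler_normD _ _) _.
by rewrite [X in _ + X]distrC; move: h hk hi; set a := _^-1 => h hk hi; lra.
Qed.

Lemma mixing_measure_real (T : R -> X -> X) (X0 : set X) (S : R -> X -> X)
    (sepX : separable X)
    (C0T : @C0_semigroup R RealScalars X T)
    (denseX0 : dense X0)
    (TS : forall t x, 0 < t -> X0 x -> T t (S t x) = x)
    (TSB : forall r t x, 0 < t -> t < r -> X0 x -> T t (S r x) = S (r - t) x)
    (pettisT : forall x, X0 x -> @pettis_integrable R RealScalars X (fun t => T t x))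
    (pettisS : forall x, X0 x -> @pettis_integrable R RealScalars X (fun t => S t x)) :
  exists mu : probability (borel X) R,
    [/\ invariant_measure T mu, strongly_mixing T mu & full_support mu].
Proof.
have [linT contT T0 TD orbT] := C0T.
have [x [X0x xX]] := dense_sequence_in sepX denseX0.
pose v j := two_sided_orbit T S (x j).
have vT j s t : 0 <= t -> T t (v j s) = v j (s + t).
  by move=> t0; apply: two_sided_orbit_shift => // *; [exact: TS|exact: TSB].
have vP j : line_pettis (v j).
  by apply: two_sided_orbit_pettis => // *; [exact: TS|exact: TSB|exact: pettisT|exact: pettisS].
have v0 j s : 0 <= s -> v j s = T s (x j) by rewrite /v /two_sided_orbit => ->.
(* The mark [n] encodes a pair (j, l): the orbit of [x j], with pulses of length 1/(l + 1). Integers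
   encoding nothing repeat the pair (0, 0), which is harmless. *)
pose f n : nat * nat := odflt (0%N, 0%N) (unpickle n).
pose delta n : R := (f n).2.+1%:R^-1.
have delta_gt0 n : 0 < delta n by rewrite invr_gt0 ltr0n.
pose u n s := (delta n)^-1 *: v (f n).1 s.
have uP n : line_pettis (u n) by exact: line_pettisZ.
have uT n s t : 0 <= t -> T t (u n s) = u n (s + t).
  move=> t0; rewrite /u -vT//.
  pose Tt : {linear X -> X} := HB.pack (T t) (GRing.isLinear.Build R X X _ _ (linT t t0)).
  exact: (linearZ_LR Tt).
have tail n : exists p : R * rat, [/\ 0 < p.1, p.1 + delta n <= ratr p.2 &
   forall E : set (measurableTypeR R), measurable E -> E `&` `[- p.1, p.1] = set0 ->
     `|pettis_int (u n) E| <= 2^-1 ^+ n].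
  have [|M [M0 hM]] := pettis_int_tail (uP n) sepX (e := 2^-1 ^+ n).
    by rewrite exprn_gt0.
  exists (M, (Num.truncn (M + delta n)).+1%:R); split => //=.
  by rewrite ratr_nat; exact: ltW (truncnS_gt _).
have [p Hp] := choice tail.
have B0 n : 0 < ratr (p n).2 :> R.
  by have [h1 h2 _] := Hp n; have := delta_gt0 n; lra.
(* The window [-B, B[ has length [2 * B], so this intensity puts a mean number of exactly
   [2^-1 ^+ n] points in it. *)
pose lam0 n : R := 2^-1 ^+ n / (2 * ratr (p n).2).
have lam0_gt0 n : 0 < lam0 n by rewrite divr_gt0 ?exprn_gt0// mulr_gt0.
pose lam n : {nonneg R} := NngNum (ltW (lam0_gt0 n)).
have lamB n : cell_mass lam (n, (- (p n).2, (p n).2)) <= 2^-1 ^+ n.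
  have b0 := ltW (B0 n).
  rewrite /cell_mass [X in X * _]/= [X in _ * X]/= rmorphN opprK max_r ?addr_ge0//.
  rewrite (_ : _ + _ = 2 * ratr (p n).2); last by ring.
  by rewrite /lam0 divfK// gt_eqF// mulr_gt0.
have [Q QE] := noise_exists lam.
have tailM n E mE EM := let: And3 _ _ h := Hp n in h E mE EM.
have MB n : (p n).1 + delta n <= ratr (p n).2 by have [] := Hp n.
have [mu [muE mu_inv mu_mix]] :=
  psi_law sepX uP delta_gt0 tailM MB lamB QE linT contT uT.
exists mu; split.
- exact: (invariant_continuous_time contT TD orbT mu_inv).
- exact: (mixing_continuous_time contT TD orbT mu_inv mu_mix).
move=> U oU U0; rewrite muE.
apply: (psi_full_support sepX uP delta_gt0 tailM MB lamB QE) => //.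
move=> y e e0.
have [j hj] := xX y e e0.
have /cvgrPdist_le /(_ e e0) : T t (x j) @[t --> 0^'+] --> T 0 (x j).
  by have /continuous_within_itvcyP[_] := orbT (x j).
rewrite T0 => -[r /= r0 hr].
(* The orbit must stay close to [x j] up to time [2 * delta], because a pulse that starts in [0,
   eta[ may reach [delta + eta]. *)
have [l hl] : exists l : nat, 2 * l.+1%:R^-1 < r.
  exists (Num.truncn (2 / r)).
  by rewrite -ltr_pdivlMl// invf_plt ?posrE ?mulr_gt0 ?invr_gt0// invfM invrK truncnS_gt.
exists (pickle (j, l)), (x j); split; first exact: ltW.
move=> s /andP[s0 s2]; rewrite /u /f pickleK /= scalerA mulfV ?scale1r; last first.
  by rewrite gt_eqF.
rewrite v0// distrC; have [->|sn0] := eqVneq s 0; first by rewrite T0 subrr normr0 ltW.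
have sp : 0 < s by rewrite lt_def sn0.
apply: hr => //=; rewrite sub0r normrN gtr0_norm//.
move: s2; rewrite /delta /f pickleK /= => s2; exact: le_lt_trans hl.
Qed.

End real_case.

Section complex_case.
Context (R : realType) (X : completeNormedModType R[i]).
Local Notation Y := (realify R X).

Lemma real_complex_continuous : continuous (fun a : R => (a%:C)%C : R[i]^o).
Proof.
move=> a; apply/cvgrPdist_lt => e e0; have [e1 e2] : e = ((complex.Re e)%:C)%C /\ 0 < complex.Re e.
  by move: e0; rewrite ltcE; case: (e) => x y /= /andP[/eqP -> ?].
near=> b; rewrite e1 -rmorphB/= normc_def/= expr0n addr0 sqrtr_sqr ltcR.
by near: b; exact: cvgr_dist_lt.
Unshelve. all: by end_near. Qed.

(* A real functional [phi] is the real part of the complex functional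
   [x |-> phi x - i phi (i x)]. *)
Lemma complexify_linear (phi : {linear Y -> R^o}) : continuous phi ->
  exists psi : {linear X -> R[i]^o}, continuous psi /\
    forall x, complex.Re (psi x) = phi x.
Proof.
move=> cphi; pose im (x : X) : R := - phi ('i%C *: x).
pose f (x : X) : R[i]^o := Complex (phi x) (im x).
have phiE (a b : R) (x : X) : phi (Complex a b *: x) = a * phi x + b * phi ('i%C *: x).
  rewrite [Complex a b]complexE /= scalerDl [('i * _)%C]mulrC -scalerA.
  rewrite -[LHS]/(phi ((a *: (x : Y)) + (b *: ('i%C *: x : Y)))).
  by rewrite linearD !linearZ.
have lf : linear f.
  move=> [a b] x y; rewrite /f /im scalerDr scalerA.
  have -> : ('i * Complex a b)%C = Complex (- b) a by simpc.
  have -> : phi (Complex a b *: x + y) = a * phi x + b * phi ('i%C *: x) + phi y.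
    by rewrite -phiE; exact: (raddfD phi (Complex a b *: x : Y) y).
  have -> : phi (Complex (- b) a *: x + 'i%C *: y) =
      - b * phi x + a * phi ('i%C *: x) + phi ('i%C *: y).
    by rewrite -phiE; exact: (raddfD phi (Complex (- b) a *: x : Y) ('i%C *: y)).
  move: (phi x) (phi ('i%C *: x)) (phi y) (phi ('i%C *: y)) => p q r s.
  by apply/eqP; rewrite eq_complex /=; apply/andP; split; apply/eqP; ring.
pose psi : {linear X -> R[i]^o} := HB.pack f (GRing.isLinear.Build R[i] X R[i]^o _ f lf).
exists psi; split => // x.
have -> : (psi : X -> R[i]^o) = fun x => ((phi x)%:C)%C + 'i%C *: ((im x)%:C)%C.
  by apply/funext => z; exact: complexE.
have cX : continuous (fun z : X => 'i%C *: z) by exact: scaler_continuous.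
have cphiX : continuous (fun z : X => phi ('i%C *: z) : R^o).
  by move=> z; apply: (@continuous_comp X Y R^o (fun z => 'i%C *: z) phi); [exact: cX|exact: cphi].
have cim : continuous (im : X -> R^o) by move=> z; exact: (cvgN (cphiX z)).
have cC (g : X -> R^o) : continuous g -> continuous (fun z => (g z)%:C%C : R[i]^o).
  move=> cg z; apply: (@continuous_comp X R^o R[i]^o g (fun a : R => (a%:C)%C : R[i]^o)).
    exact: cg.
  exact: real_complex_continuous.
have cS : continuous (fun z : R[i]^o => 'i%C *: z : R[i]^o) by exact: scaler_continuous.
apply: (@cvgD R[i] R[i]^o); first exact: (cC phi).
apply: (@continuous_comp X R[i]^o R[i]^o (fun z => ((im z)%:C)%C) (fun z => 'i%C *: z)).
  exact: (cC im).
exact: cS.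
Qed.

(** Each real functional is the real part of a complex one, and the real part of a complex integral
    is the integral of the real part; the same vector therefore serves as the integral. *)
Lemma realify_pettis (f : R -> X) : @pettis_integrable R ComplexScalars X f ->
  @pettis_integrable R RealScalars Y f.
Proof.
move=> [fi fE]; split=> [phi cphi|E mE E0].
  have [psi [cpsi psiE]] := complexify_linear cphi.
  have [h _] := fi psi cpsi.
  by apply: eq_integrable h => //; [exact: sub_caratheodory|move=> t _ /=; rewrite psiE].
have [x Hx] := fE E mE E0; exists x => phi cphi.
have [psi [cpsi psiE]] := complexify_linear cphi.
rewrite -psiE (Hx psi cpsi) /=.
by apply: eq_Rintegral => t _; rewrite /= psiE.
Qed.

End complex_case.

Theorem theorem3 (R : realType) (k : scalars)
    (X : completeNormedModType (scalar_field R k))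
    (T : R -> X -> X) (X0 : set X) (S : R -> X -> X)
    (sepX : separable X)
    (C0T : C0_semigroup T)
    (denseX0 : dense X0)
    (SX0 : forall t x, 0 < t -> X0 x -> X0 (S t x))
    (TS : forall t x, 0 < t -> X0 x -> T t (S t x) = x)
    (TSB : forall r t x, 0 < t -> t < r -> X0 x -> T t (S r x) = S (r - t) x)
    (pettisT : forall x, X0 x -> pettis_integrable (fun t => T t x))
    (pettisS : forall x, X0 x -> pettis_integrable (fun t => S t x)) :
  exists mu : probability (borel X) R,
    [/\ invariant_measure T mu, strongly_mixing T mu & full_support mu].
Proof.
case: k X T X0 S sepX C0T denseX0 SX0 TS TSB pettisT pettisS => X T X0 S sepX C0T denseX0 SX0 TS TSB pettisT pettisS.
  exact: (mixing_measure_real sepX C0T denseX0 TS TSB pettisT pettisS).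
apply: (@mixing_measure_real R (realify R X) T X0 S sepX _ denseX0 TS TSB).
- have [linT contT T0 TD orbT] := C0T.
  split => //.
  by move=> t t0 a x y; have := linT t t0 (a%:C)%C x y.
- by move=> x /pettisT; exact: realify_pettis.
- by move=> x /pettisS; exact: realify_pettis.
Qed.
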